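(* Let $(T,\mathcal F)$ be a tensor functor between braided unital monoidal Ab-categories $(\mathcal C,\otimes,\Phi,\Psi)$ and $(\mathcal C',\otimes',\Phi',\Psi')$, and let $(A,m,\eta,\sigma)$ be a ribbon algebra in $\mathcal C$. Then $A':=T(A)$ is an algebra in $\mathcal C'$ with product $m':=\bar T(m)$ (that is, $m'=T(m)\mathcal F_{A,A}$), unit $\eta':=T(\eta)$ and ribbon structure $\sigma':=T(\sigma)$. Moreover, $\varphi\mapsto\bar T(\varphi)$ gives a morphism of cocyclic modules $$\bar T:C^n(\mathcal C;A,\sigma)\to C^n(\mathcal C';A',\sigma').$$ If in addition $\mathcal C$ and $\mathcal C'$ are gauge equivalent (via $(T,\mathcal F)$, i.e. $T$ is invertible), then this morphism is an isomorphism of cocyclic modules and therefore induces isomorphisms $HH^*(\mathcal C;A,\sigma)\cong HH^*(\mathcal C';A',\sigma')$ and $HC^*(\mathcal C;A,\sigma)\cong HC^*(\mathcal C';A',\sigma')$ between the braided Hochschild and braided cyclic cohomologies of $A$ in $\mathcal C$ and $A'$ in $\mathcal C'$.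
   Context: Braided monoidal Ab-category: a category $\mathcal C$ with a functor $\otimes:\mathcal C\times\mathcal C\to\mathcal C$, natural isomorphisms $\Phi_{U,V,W}:U\otimes(V\otimes W)\to(U\otimes V)\otimes W$ (pentagon identity) and $\Psi_{U,V}:U\otimes V\to V\otimes U$ (two hexagon identities), and a unit object $\mathbf 1$. It is assumed that $U\otimes\mathbf 1=\mathbf 1\otimes U=U$, that $\Phi_{U,V,W}=\mathrm{id}$ when one of $U,V,W$ is $\mathbf 1$, and similarly $\Psi_{U,\mathbf 1}=\Psi_{\mathbf 1,U}=\mathrm{id}$. All $\mathrm{Hom}(U,V)$ are abelian groups with composition and tensor product of morphisms bilinear. Bracketings: $\Lambda_1=\{\mathrm{id}\}$, $\Lambda_2=\{\otimes\}$, and for $n>2$, $\Lambda_n$ is the set of pairs $(\alpha,\beta)$ with $\alpha\in\Lambda_k,\beta\in\Lambda_l$, $k,l<n$, $k+l=n$. For $\alpha\in\Lambda_n$, $(U_1\otimes\cdots\otimes U_n;\alpha)$ is the object of $\mathcal C$ obtained by bracketing the $n$-fold tensor product according to $\alpha$; thus the object for $(\alpha,\beta)$ is $(U_1\otimes\cdots\otimes U_k;\alpha)\otimes(U_{k+1}\otimes\cdots\otimes U_n;\beta)$. By Mac Lane's coherence theorem there is a unique family of isomorphisms $I^\alpha_\beta(U_1,\dots,U_m):(U_1\otimes\cdots\otimes U_m;\alpha)\to(U_1\otimes\cdots\otimes U_m;\beta)$ with $I^\alpha_\beta=\mathrm{id}$ for $m=1,2$, $I^\beta_\gamma I^\alpha_\beta=I^\alpha_\gamma$,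 $I^{\alpha_1}_{\alpha_2}\otimes I^{\beta_1}_{\beta_2}=I^{(\alpha_1,\beta_1)}_{(\alpha_2,\beta_2)}$ and $I^{(\mathrm{id},\otimes)}_{(\otimes,\mathrm{id})}=\Phi$. Strict extension $\bar{\mathcal C}$: objects are formal words $U_1\otimes\cdots\otimes U_n$, $n\ge1$, of objects of $\mathcal C$, where $U_i\neq\mathbf 1$ for all $i$ if $n>1$. Morphisms $U_1\otimes\cdots\otimes U_m\to V_1\otimes\cdots\otimes V_n$ are equivalence classes $[f]$ of morphisms $f:(U_1\otimes\cdots\otimes U_m;\alpha)\to(V_1\otimes\cdots\otimes V_n;\beta)$ of $\mathcal C$ ($\alpha\in\Lambda_m,\beta\in\Lambda_n$ arbitrary), where $f_1\sim f_2$ iff $f_2=I^{\beta_1}_{\beta_2}f_1I^{\alpha_2}_{\alpha_1}$. Each class has exactly one representative $f^\alpha_\beta$ for each $(\alpha,\beta)$. Composition: $gf=[g^\beta_\gamma f^\alpha_\beta]$; sum: $[f^\alpha_\beta+g^\alpha_\beta]$. The tensor product of objects is concatenation of words, with $\mathbf 1$ as strict unit; $f\otimes f'=[f^\alpha_\beta\otimes f'^{\alpha'}_{\beta'}]$ regarded as a morphism with bracketings $(\alpha,\alpha')$, $(\beta,\beta')$. The braiding of $\bar{\mathcal C}$ (also written $\Psi$) between $U_1\otimes\cdots\otimes U_m$ and $V_1\otimes\cdots\otimes V_n$ is the class of $\Psi_{(U_1\otimes\cdots\otimes U_m;\alpha),(V_1\otimes\cdots\otimes V_n;\beta)}$. With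 this $\bar{\mathcal C}$ is a strict braided monoidal Ab-category. Tensor functor $(T,\mathcal F)$: an additive functor $T:\mathcal C\to\mathcal C'$ with $T(\mathbf 1)=\mathbf 1'$ and isomorphisms $\mathcal F_{U,V}:T(U)\otimes'T(V)\to T(U\otimes V)$ in $\mathcal C'$, natural in $U,V$, with $\mathcal F_{U,\mathbf 1}=\mathcal F_{\mathbf 1,U}=\mathrm{id}_{T(U)}$, such that for all $U,V,W$ $$T(\Phi_{U,V,W})\mathcal F_{U,V\otimes W}(\mathrm{id}_{T(U)}\otimes'\mathcal F_{V,W})=\mathcal F_{U\otimes V,W}(\mathcal F_{U,V}\otimes'\mathrm{id}_{T(W)})\Phi'_{T(U),T(V),T(W)},$$ $$T(\Psi_{U,V})\mathcal F_{U,V}=\mathcal F_{V,U}\Psi'_{T(U),T(V)}.$$ A gauge transformation is a tensor functor with $T$ invertible; then the categories are called gauge equivalent. Isomorphisms $S_\alpha(U_1,\dots,U_m):(T(U_1)\otimes'\cdots\otimes'T(U_m);\alpha)\to T((U_1\otimes\cdots\otimes U_m;\alpha))$ are defined inductively: $S_\alpha(U)=\mathrm{id}$ for $m=1$, $S_\alpha(U_1,U_2)=\mathcal F_{U_1,U_2}$ for $m=2$, and $S_{(\alpha,\beta)}(U_1,\dots,U_m)=\mathcal F_{(U_1\otimes\cdots\otimes U_k;\alpha),(U_{k+1}\otimes\cdots\otimes U_m;\beta)}\,(S_\alpha(U_1,\dots,U_k)\otimes'S_\beta(U_{k+1},\dots,U_m))$. The functor $\bar T:\bar{\mathcal C}\to\bar{\mathcal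 C'}$ is $\bar T(U_1\otimes\cdots\otimes U_m)=T(U_1)\otimes'\cdots\otimes'T(U_m)$ (tensor product in $\bar{\mathcal C'}$), and $\bar T(f)$ is the class of $S_\beta^{-1}T(f^\alpha_\beta)S_\alpha$ for any $\alpha,\beta$. An algebra in $\mathcal C$ is an object $A$ of $\mathcal C$ with morphisms $m:A\otimes A\to A$, $\eta:\mathbf 1\to A$ such that $m(\mathrm{id}\otimes m)=m(m\otimes\mathrm{id})$ in $\bar{\mathcal C}$ and $m(\mathrm{id}\otimes\eta)=m(\eta\otimes\mathrm{id})=\mathrm{id}$. A ribbon algebra is an algebra with an automorphism $\sigma:A\to A$ (of the object $A$), called its ribbon structure, such that $m(\sigma\otimes\sigma)\Psi_{A,A}\Psi_{A,A}=\sigma m$ and $\sigma\eta=\eta$. Cocyclic module of a ribbon algebra: in $\bar{\mathcal C}$ put, with $\mathrm{id}_k=\mathrm{id}_{A^{\otimes k}}$, $d_i^{(n)}=\mathrm{id}_i\otimes m\otimes\mathrm{id}_{n-1-i}$ ($0\le i\le n-1$) and $d_n^{(n)}=(m\otimes\mathrm{id}_{n-1})(\sigma\otimes\mathrm{id}_n)\Psi_{A^{\otimes n},A}$, from $A^{\otimes(n+1)}$ to $A^{\otimes n}$; $s_i^{(n)}=\mathrm{id}_{i+1}\otimes\eta\otimes\mathrm{id}_{n-i}$ ($0\le i\le n$), from $A^{\otimes(n+1)}$ to $A^{\otimes(n+2)}$; $\lambda_n=(-1)^n(\sigma\otimes\mathrm{id}_n)\Psi_{A^{\otimes n},A}$ on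 $A^{\otimes(n+1)}$. Let $C^n(\mathcal C;A,\sigma)=\{\varphi\in\mathrm{Hom}_{\bar{\mathcal C}}(A^{\otimes(n+1)},\mathbf 1)\mid\varphi\lambda_n^{n+1}=\varphi\}$. Precomposition gives $d_i:C^{n-1}\to C^n$, $s_i:C^{n+1}\to C^n$, $\lambda:C^n\to C^n$, the face, degeneracy and cyclicity maps of a cocyclic module; a morphism of cocyclic modules is a family of additive maps commuting with all $d_i,s_i,\lambda$. $HH^*(\mathcal C;A,\sigma)$ is the cohomology of $(C^*,\ d=\sum_{i=0}^n(-1)^id_i:C^{n-1}\to C^n)$, and $HC^*(\mathcal C;A,\sigma)$ that of the subcomplex $C^n_\lambda=\{\varphi\mid\varphi\lambda_n=\varphi\}$. *)

(* Defs.v *)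
From HB Require Import structures.
From mathcomp Require Import all_boot all_algebra.
From mathcomp Require Import generic_quotient ring_quotient.
From mathcomp.classical Require Import boolp.

Set Implicit Arguments.
Unset Strict Implicit.
Unset Printing Implicit Defensive.

Import GRing.Theory.
Local Open Scope ring_scope.
Local Open Scope quotient_scope.

Reserved Notation "g \c f" (at level 40, left associativity).
Reserved Notation "U \ox V" (at level 35, right associativity).
Reserved Notation "f \om g" (at level 35, right associativity).
Reserved Notation "W \bx V" (at level 35, right associativity).
Reserved Notation "f \bm g" (at level 35, right associativity).

Record abCat := AbCat {
  obj :> Type;
  hom : obj -> obj -> zmodType;
  idm : forall U, hom U U;
  comp : forall U V W, hom V W -> hom U V -> hom U W;
  comp1m : forall U V (f : hom U V), comp (idm V) f = f;
  compm1 : forall U V (f : hom U V), comp f (idm U) = f;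
  compA : forall U V W Z (h : hom W Z) (g : hom V W) (f : hom U V),
    comp h (comp g f) = comp (comp h g) f;
  compDl : forall U V W (g g' : hom V W) (f : hom U V),
    comp (g + g') f = comp g f + comp g' f;
  compDr : forall U V W (g : hom V W) (f f' : hom U V),
    comp g (f + f') = comp g f + comp g f' }.

Arguments hom {a} U V.
Arguments idm {a} U.
Arguments comp {a U V W} g f.

Notation "g \c f" := (comp g f) : ring_scope.

(* The identity of [U], seen as a morphism [U -> V] when [U] and [V] are the
   same object.  It is how equalities between objects (strict units, strict
   associativity) enter equations between morphisms; its value does not depend
   on the proof of equality. *)
Definition coe (C : abCat) (U V : C) (e : U = V) : hom U V :=
  match e in _ = V' return hom U V' with erefl => idm U end.

Record iso (C : abCat) (U V : C) := Iso {
  iso_hom :> hom U V;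
  iso_inv : hom V U;
  isoK : iso_inv \c iso_hom = idm U;
  isoVK : iso_hom \c iso_inv = idm V }.

Definition is_iso (C : abCat) (U V : C) (f : hom U V) :=
  exists g : hom V U, g \c f = idm U /\ f \c g = idm V.

Section Isos.
Variable C : abCat.
Implicit Types U V W : C.

Definition iid U : iso U U := Iso (comp1m (idm U)) (comp1m (idm U)).

Definition iinv U V (f : iso U V) : iso V U := Iso (isoVK f) (isoK f).

Lemma icomp_K U V W (g : iso V W) (f : iso U V) :
  (iso_inv f \c iso_inv g) \c (g \c f) = idm U.
Proof. by rewrite compA -(compA (iso_inv f)) isoK compm1 isoK. Qed.

Lemma icomp_VK U V W (g : iso V W) (f : iso U V) :
  (g \c f) \c (iso_inv f \c iso_inv g) = idm W.
Proof. by rewrite compA -(compA (iso_hom g)) isoVK compm1 isoVK. Qed.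

Definition icomp U V W (g : iso V W) (f : iso U V) : iso U W :=
  Iso (icomp_K g f) (icomp_VK g f).

Lemma coeK U V (e : U = V) : coe (esym e) \c coe e = idm U.
Proof. by case: V / e; rewrite comp1m. Qed.

Lemma coeVK U V (e : U = V) : coe e \c coe (esym e) = idm V.
Proof. by case: V / e; rewrite comp1m. Qed.

Definition icoe U V (e : U = V) : iso U V := Iso (coeK e) (coeVK e).

Lemma coe_id U (e : U = U) : coe e = idm U.
Proof. by rewrite (Prop_irrelevance e erefl). Qed.

Lemma coe_coe U V W (e1 : U = V) (e2 : V = W) :
  coe e2 \c coe e1 = coe (etrans e1 e2).
Proof. by case: W / e2; rewrite comp1m. Qed.

Lemma coe_irr U V (e e' : U = V) : coe e = coe e'.
Proof. by rewrite (Prop_irrelevance e e'). Qed.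

Lemma comp0m U V W (f : hom U V) : (0 : hom V W) \c f = 0.
Proof. by apply: (@addIr _ (0 \c f)); rewrite -compDl !add0r. Qed.

Lemma compm0 U V W (g : hom V W) : g \c (0 : hom U V) = 0.
Proof. by apply: (@addIr _ (g \c 0)); rewrite -compDr !add0r. Qed.

Lemma compNm U V W (g : hom V W) (f : hom U V) : (- g) \c f = - (g \c f).
Proof. by apply/eqP; rewrite -subr_eq0 opprK -compDl addNr comp0m. Qed.

Lemma compmN U V W (g : hom V W) (f : hom U V) : g \c (- f) = - (g \c f).
Proof. by apply/eqP; rewrite -subr_eq0 opprK -compDr addNr compm0. Qed.

Lemma compBl U V W (g g' : hom V W) (f : hom U V) :
  (g - g') \c f = g \c f - g' \c f.
Proof. by rewrite compDl compNm. Qed.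

Lemma compA1 U V W Z (g : hom V W) (f : hom U V) h (x : hom W Z) :
  g \c f = h -> x \c g \c f = x \c h.
Proof. by move=> e; rewrite -compA e. Qed.

Lemma compA2 U V V' W Z (g : hom V W) (f : hom U V) (k : hom V' W)
    (h : hom U V') (x : hom W Z) :
  g \c f = k \c h -> x \c g \c f = x \c k \c h.
Proof. by move=> e; rewrite -compA e compA. Qed.

Lemma comp_conj U0 U1 U2 V0 V1 V2 (k : hom V1 V2) (h : hom V0 V1)
    (f : hom U2 V0) (i : hom U1 U2) (j : hom U0 U1) :
  k \c (h \c f \c i) \c j = (k \c h) \c f \c (i \c j).
Proof. by rewrite !compA. Qed.

Fixpoint pow_end U (f : hom U U) (n : nat) : hom U U :=
  if n is k.+1 then f \c pow_end f k else idm U.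

End Isos.

(* The unit is strict on objects and the unit constraints are identities; so
   tensoring with the unit is the identity on morphisms too, and the
   associator and the braiding are identities when an argument is the unit. *)
Record braidedCat := BraidedCat {
  bcat :> abCat;
  tens : bcat -> bcat -> bcat;
  tensm : forall U U' V V' : bcat,
    hom U U' -> hom V V' -> hom (tens U V) (tens U' V');
  tensm_id : forall U V : bcat, tensm (idm U) (idm V) = idm (tens U V);
  tensm_comp : forall (U U' U'' V V' V'' : bcat)
    (f' : hom U' U'') (f : hom U U') (g' : hom V' V'') (g : hom V V'),
    tensm (f' \c f) (g' \c g) = tensm f' g' \c tensm f g;
  tensmDl : forall (U U' V V' : bcat) (f f' : hom U U') (g : hom V V'),
    tensm (f + f') g = tensm f g + tensm f' g;
  tensmDr : forall (U U' V V' : bcat) (f : hom U U') (g g' : hom V V'),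
    tensm f (g + g') = tensm f g + tensm f g';
  one : bcat;
  tensU1 : forall U : bcat, tens U one = U;
  tens1U : forall U : bcat, tens one U = U;
  tensm1 : forall (U V : bcat) (f : hom U V)
    (eU : tens U one = U) (eV : tens V one = V),
    coe eV \c tensm f (idm one) = f \c coe eU;
  tens1m : forall (U V : bcat) (f : hom U V)
    (eU : tens one U = U) (eV : tens one V = V),
    coe eV \c tensm (idm one) f = f \c coe eU;
  Phi : forall U V W : bcat, iso (tens U (tens V W)) (tens (tens U V) W);
  Phi_nat : forall (U U' V V' W W' : bcat)
    (f : hom U U') (g : hom V V') (h : hom W W'),
    Phi U' V' W' \c tensm f (tensm g h) = tensm (tensm f g) h \c Phi U V W;
  pentagon : forall U V W Z : bcat,
    Phi (tens U V) W Z \c Phi U V (tens W Z) =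
    tensm (Phi U V W) (idm Z) \c Phi U (tens V W) Z
      \c tensm (idm U) (Phi V W Z);
  Phi1UV : forall (U V : bcat) (e : tens one (tens U V) = tens (tens one U) V),
    iso_hom (Phi one U V) = coe e;
  PhiU1V : forall (U V : bcat) (e : tens U (tens one V) = tens (tens U one) V),
    iso_hom (Phi U one V) = coe e;
  PhiUV1 : forall (U V : bcat) (e : tens U (tens V one) = tens (tens U V) one),
    iso_hom (Phi U V one) = coe e;
  Psi : forall U V : bcat, iso (tens U V) (tens V U);
  Psi_nat : forall (U U' V V' : bcat) (f : hom U U') (g : hom V V'),
    Psi U' V' \c tensm f g = tensm g f \c Psi U V;
  hexagon1 : forall U V W : bcat,
    Phi W U V \c Psi (tens U V) W \c Phi U V W =
    tensm (Psi U W) (idm V) \c Phi U W V \c tensm (idm U) (Psi V W);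
  hexagon2 : forall U V W : bcat,
    iso_inv (Phi V W U) \c Psi U (tens V W) \c iso_inv (Phi U V W) =
    tensm (idm V) (Psi U W) \c iso_inv (Phi V U W) \c tensm (Psi U V) (idm W);
  PsiU1 : forall (U : bcat) (e : tens U one = tens one U),
    iso_hom (Psi U one) = coe e;
  Psi1U : forall (U : bcat) (e : tens one U = tens U one),
    iso_hom (Psi one U) = coe e }.

Arguments tens {b} U V.
Arguments tensm {b U U' V V'} f g.
Arguments one {b}.
Arguments Phi {b} U V W.
Arguments Psi {b} U V.

Notation "U \ox V" := (tens U V) : ring_scope.
Notation "f \om g" := (tensm f g) : ring_scope.

Section TensorIso.
Variable C : braidedCat.

Lemma itens_K (U U' V V' : C) (f : iso U U') (g : iso V V') :
  (iso_inv f \om iso_inv g) \c (f \om g) = idm (U \ox V).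
Proof. by rewrite -tensm_comp !isoK tensm_id. Qed.

Lemma itens_VK (U U' V V' : C) (f : iso U U') (g : iso V V') :
  (f \om g) \c (iso_inv f \om iso_inv g) = idm (U' \ox V').
Proof. by rewrite -tensm_comp !isoVK tensm_id. Qed.

Definition itens (U U' V V' : C) (f : iso U U') (g : iso V V') :
  iso (U \ox V) (U' \ox V') := Iso (itens_K f g) (itens_VK f g).

End TensorIso.

(* A bracketing together with the word it brackets: the binary trees whose
   leaves, read from left to right, are U_1, ..., U_n are the pairs of the word
   U_1 ... U_n and an element of Lambda_n. *)
Inductive tree (T : Type) := Leaf (_ : T) | Node (_ _ : tree T).

Fixpoint leaves T (t : tree T) : seq T :=
  match t with Leaf U => [:: U] | Node a b => leaves a ++ leaves b end.

Fixpoint tree_map T T' (f : T -> T') (t : tree T) : tree T' :=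
  match t with
  | Leaf U => Leaf (f U)
  | Node a b => Node (tree_map f a) (tree_map f b)
  end.

Lemma leaves_map T T' (f : T -> T') (t : tree T) :
  leaves (tree_map f t) = map f (leaves t).
Proof. by elim: t => //= a -> b ->; rewrite map_cat. Qed.

(* [graft t s] brackets the leaves of [t] to the right, on top of [s]. *)
Fixpoint graft T (t s : tree T) : tree T :=
  match t with
  | Leaf _ => Node t s
  | Node a b => graft a (graft b s)
  end.

Fixpoint rcomb T (t : tree T) : tree T :=
  match t with Leaf _ => t | Node a b => graft a (rcomb b) end.

Fixpoint comb T (U : T) (w : seq T) : tree T :=
  if w is V :: w' then Node (Leaf U) (comb V w') else Leaf U.

Lemma leaves_comb T (U : T) w : leaves (comb U w) = U :: w.
Proof. by elim: w U => //= V w IH U; rewrite IH. Qed.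

Lemma leaves_cons T (t : tree T) : exists U w, leaves t = U :: w.
Proof.
elim: t => [U|a [U [w ea]] b _]; first by exists U, [::].
by exists U, (w ++ leaves b); rewrite /= ea.
Qed.

Lemma graft_comb T (t : tree T) U w V v :
  leaves t = U :: w -> graft t (comb V v) = comb U (w ++ V :: v).
Proof.
elim: t U w V v => [U0|a IHa b IHb] U w V v /=; first by case=> -> <-.
have [Ua [wa ea]] := leaves_cons a; have [Ub [wb eb]] := leaves_cons b.
rewrite ea eb /= => -[<- <-].
by rewrite (IHb _ _ _ _ eb) (IHa _ _ _ _ ea) -catA.
Qed.

Lemma rcomb_comb T (t : tree T) U w : leaves t = U :: w -> rcomb t = comb U w.
Proof.
elim: t U w => [U0|a _ b IHb] U w /=; first by case=> -> <-.
have [Ua [wa ea]] := leaves_cons a; have [Ub [wb eb]] := leaves_cons b.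
rewrite ea eb => -[<- <-].
by rewrite (IHb _ _ eb) (graft_comb _ _ ea).
Qed.

Lemma eq_rcomb T (s t : tree T) : leaves s = leaves t -> rcomb s = rcomb t.
Proof.
have [U [w e]] := leaves_cons t => es.
by rewrite (rcomb_comb e) (rcomb_comb (etrans es e)).
Qed.

Lemma eq_rcomb_graft T (t s : tree T) : graft t s = graft (rcomb t) s.
Proof.
have graftA (a : tree T) : forall b c, graft (graft a b) c = graft a (graft b c).
  by elim: a => //= a1 IH1 a2 IH2 b c; rewrite IH1 IH2.
by elim: t s => //= a IHa b IHb s; rewrite IHb graftA.
Qed.

Section Coherence.
Variable C : braidedCat.
Implicit Types s t : tree C.

Fixpoint ev t : C :=
  match t with Leaf U => U | Node a b => ev a \ox ev b end.

Fixpoint graft_iso t s : iso (ev (Node t s)) (ev (graft t s)) :=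
  match t return iso (ev (Node t s)) (ev (graft t s)) with
  | Leaf U => iid (ev (Node (Leaf U) s))
  | Node a b =>
      icomp (graft_iso a (graft b s))
        (icomp (itens (iid (ev a)) (graft_iso b s))
               (iinv (Phi (ev a) (ev b) (ev s))))
  end.

Fixpoint rcomb_iso t : iso (ev t) (ev (rcomb t)) :=
  match t return iso (ev t) (ev (rcomb t)) with
  | Leaf U => iid U
  | Node a b =>
      icomp (graft_iso a (rcomb b)) (itens (iid (ev a)) (rcomb_iso b))
  end.

Definition tree_iso s t (e : s = t) : iso (ev s) (ev t) :=
  icoe (congr1 ev e).

(* The coherence isomorphism from the bracketing [s] to the bracketing [t] of
   one word, going through the bracketing to the right.  That it is Mac Lane's
   family is [Icoh_id], [Icoh_comp], [Icoh_tens] and [Icoh_Phi] below. *)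
Definition Icoh s t (e : leaves s = leaves t) : iso (ev s) (ev t) :=
  icomp (iinv (rcomb_iso t)) (icomp (tree_iso (eq_rcomb e)) (rcomb_iso s)).

Lemma Icoh_irr s t (e e' : leaves s = leaves t) : Icoh e = Icoh e'.
Proof. by rewrite (Prop_irrelevance e e'). Qed.

Lemma Icoh_id t (e : leaves t = leaves t) : Icoh e = idm (ev t) :> hom _ _.
Proof. by rewrite /= coe_id comp1m isoK. Qed.

Lemma Icoh_comp r s t (e1 : leaves r = leaves s) (e2 : leaves s = leaves t) :
  Icoh e2 \c Icoh e1 = Icoh (etrans e1 e2).
Proof.
rewrite /= !compA (compA1 _ (isoVK _)) compm1 (compA1 _ (coe_coe _ _)).
by congr (_ \c _ \c _); apply: coe_irr.
Qed.

Lemma tensm1_comp (U V V' V'' : C) (g : hom V' V'') (f : hom V V') :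
  idm U \om (g \c f) = (idm U \om g) \c (idm U \om f).
Proof. by rewrite -tensm_comp comp1m. Qed.

Lemma tens1m_comp (U V V' V'' : C) (g : hom V' V'') (f : hom V V') :
  (g \c f) \om idm U = (g \om idm U) \c (f \om idm U).
Proof. by rewrite -tensm_comp comp1m. Qed.

Lemma PhiV_nat (U U' V V' W W' : C) (f : hom U U') (g : hom V V')
    (h : hom W W') :
  iso_inv (Phi U' V' W') \c ((f \om g) \om h) =
  (f \om (g \om h)) \c iso_inv (Phi U V W).
Proof.
rewrite -[LHS]compm1 -(isoVK (Phi U V W)) compA -(compA _ _ (iso_hom _)).
by rewrite -Phi_nat !compA isoK comp1m.
Qed.

Lemma pentagonV (U V W Z : C) :
  iso_inv (Phi U V (W \ox Z)) \c iso_inv (Phi (U \ox V) W Z) =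
  (idm U \om iso_inv (Phi V W Z)) \c iso_inv (Phi U (V \ox W) Z)
    \c (iso_inv (Phi U V W) \om idm Z).
Proof.
pose p := icomp (Phi (U \ox V) W Z) (Phi U V (W \ox Z)).
pose q := icomp (icomp (itens (Phi U V W) (iid Z)) (Phi U (V \ox W) Z))
                (itens (iid U) (Phi V W Z)).
have pq : p = q :> hom _ _ by exact: pentagon.
have -> : iso_inv (Phi U V (W \ox Z)) \c iso_inv (Phi (U \ox V) W Z) =
  iso_inv p by [].
rewrite -[LHS]compm1 -(isoVK q) -pq compA isoK comp1m /=.
by rewrite compA.
Qed.

Lemma graft_iso_coe t s s' (e : s = s')
    (e' : ev (graft t s) = ev (graft t s')) (e'' : ev s = ev s') :
  graft_iso t s' \c (idm (ev t) \om coe e'') = coe e' \c graft_iso t s.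
Proof. by case: s' / e e' e'' => e' e''; rewrite !coe_id tensm_id compm1 comp1m. Qed.

Lemma graftA T (a b c : tree T) : graft (graft a b) c = graft a (graft b c).
Proof. by elim: a b => //= a IHa b IHb t; rewrite IHa IHb. Qed.

Lemma graft_isoA a t s
    (e : ev (graft a (graft t s)) = ev (graft (graft a t) s)) :
  graft_iso (graft a t) s \c (graft_iso a t \om idm (ev s)) =
  coe e \c graft_iso a (graft t s) \c (idm (ev a) \om graft_iso t s)
    \c iso_inv (Phi (ev a) (ev t) (ev s)).
Proof.
elim: a t e => [U|a IHa b IHb] t e.
  by rewrite coe_id tensm_id compm1 /= comp1m !comp1m.
have ea : ev (graft a (graft (graft b t) s)) =
    ev (graft (graft a (graft b t)) s) by rewrite graftA.
have eb : ev (graft b (graft t s)) = ev (graft (graft b t) s).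
  by rewrite graftA.
have ec : ev (graft a (graft b (graft t s))) =
    ev (graft a (graft (graft b t) s)) by rewrite graftA.
rewrite /= !tens1m_comp !compA IHa (compA2 _ (PhiV_nat _ _ _)).
rewrite (compA1 _ (esym (tensm1_comp _ _ _))) IHb !tensm1_comp !compA.
rewrite (compA2 _ (graft_iso_coe (esym (graftA b t s)) ec _)) coe_coe.
rewrite (coe_irr _ e) -[in RHS]tensm_id (compA2 _ (PhiV_nat _ _ _)).
by rewrite (compA1 _ (pentagonV _ _ _ _)) !compA.
Qed.

Lemma rcomb_graft_iso a s (e : ev (graft a s) = ev (graft (rcomb a) s)) :
  graft_iso (rcomb a) s \c (rcomb_iso a \om idm (ev s)) =
  coe e \c graft_iso a s.
Proof.
elim: a s e => [U|a IHa b IHb] s e; first by rewrite coe_id tensm_id /= !comp1m.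
have eb : ev (graft b s) = ev (graft (rcomb b) s) by rewrite eq_rcomb_graft.
have ea : ev (graft a (graft (rcomb b) s)) = ev (graft (rcomb (Node a b)) s).
  by rewrite /= graftA.
have ec : ev (graft a (graft b s)) = ev (graft a (graft (rcomb b) s)).
  by rewrite (eq_rcomb_graft b).
rewrite /= tens1m_comp !compA graft_isoA (compA2 _ (PhiV_nat _ _ _)).
rewrite (compA1 _ (esym (tensm1_comp _ _ _))) IHb !tensm1_comp !compA.
rewrite (compA2 _ (graft_iso_coe (eq_rcomb_graft b s) ec _)) coe_coe.
by rewrite (coe_irr _ e).
Qed.

Lemma rcomb_iso_node a b
    (e : ev (rcomb (Node a b)) = ev (graft (rcomb a) (rcomb b))) :
  coe e \c rcomb_iso (Node a b) =
  graft_iso (rcomb a) (rcomb b) \c (rcomb_iso a \om rcomb_iso b).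
Proof.
rewrite /= compA -rcomb_graft_iso -compA -tensm_comp comp1m.
by rewrite compm1.
Qed.

Lemma Icoh_tens a1 b1 a2 b2 (ea : leaves a1 = leaves a2)
    (eb : leaves b1 = leaves b2)
    (e : leaves (Node a1 b1) = leaves (Node a2 b2)) :
  Icoh e = Icoh ea \om Icoh eb :> hom (ev (Node a1 b1)) (ev (Node a2 b2)).
Proof.
have e1 : ev (rcomb (Node a1 b1)) = ev (graft (rcomb a1) (rcomb b1)).
  by rewrite /= eq_rcomb_graft.
have e2 : ev (rcomb (Node a2 b2)) = ev (graft (rcomb a2) (rcomb b2)).
  by rewrite /= eq_rcomb_graft.
have ra := eq_rcomb ea; have rb := eq_rcomb eb.
have e3 : ev (graft (rcomb a1) (rcomb b1)) = ev (graft (rcomb a2) (rcomb b2)).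
  by rewrite ra rb.
have g_coe a a' b b' (fa : a = a') (fb : b = b') (f1 : ev a = ev a')
    (f2 : ev b = ev b') (f3 : ev (graft a b) = ev (graft a' b')) :
    graft_iso a' b' \c (coe f1 \om coe f2) = coe f3 \c graft_iso a b.
  case: a' / fa f1 f3 => f1 f3; case: b' / fb f2 f3 => f2 f3.
  by rewrite !coe_id tensm_id comp1m compm1.
have key : coe e2 \c (rcomb_iso (Node a2 b2) \c (Icoh ea \om Icoh eb)) =
           coe e2 \c (coe (congr1 (@ev) (eq_rcomb e))
                        \c rcomb_iso (Node a1 b1)).
  rewrite (compA (coe e2) (rcomb_iso _)) rcomb_iso_node -compA -tensm_comp.
  have inv_l c d (x : leaves c = leaves d) :
      rcomb_iso d \c Icoh x = coe (congr1 (@ev) (eq_rcomb x)) \c rcomb_iso c.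
    by rewrite /= compA isoVK comp1m.
  rewrite !inv_l tensm_comp (compA (graft_iso _ _)).
  rewrite (g_coe _ _ _ _ ra rb _ _ e3) -(compA (coe e3)).
  rewrite -(rcomb_iso_node e1) (compA (coe e3)) (compA (coe e2)) !coe_coe.
  by congr (_ \c _); apply: coe_irr.
have := congr1 (fun f => iso_inv (rcomb_iso (Node a2 b2)) \c
                         (coe (esym e2) \c f)) key.
rewrite !(compA (coe (esym e2))) coeK !comp1m compA isoK comp1m => ->.
by [].
Qed.

Lemma Icoh_Phi (U V W : C)
    (e : leaves (Node (Leaf U) (Node (Leaf V) (Leaf W))) =
         leaves (Node (Node (Leaf U) (Leaf V)) (Leaf W))) :
  iso_hom (Icoh e) = Phi U V W.
Proof.
by rewrite /= coe_id !tensm_id !comp1m !compm1 tensm_id compm1.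
Qed.

End Coherence.

Section Strict.
Variable C : braidedCat.

Definition nonunit (U : C) : bool := `[< U <> one >].

Lemma nonunitPn U : ~~ nonunit U -> U = one.
Proof. by move/asboolPn/contrapT. Qed.

Lemma nonunit1 : nonunit one = false.
Proof. by apply/negbTE/asboolPn; apply. Qed.

(* A word is nonempty, and has no unit letter if it has several letters. *)
Definition is_word (w : seq C) : bool :=
  (0 < size w)%N && ((1 < size w)%N ==> all nonunit w).

Record barobj := Barobj { word :> seq C; wordP : is_word word }.

Lemma eq_barobj (W V : barobj) : word W = word V -> W = V.
Proof.
case: W V => [w hw] [v hv] /= e; case: v / e hv => hv.
by rewrite (bool_irrelevance hw hv).
Qed.

(* Deletes the letters equal to the unit; a word with no other letter becomes
   the word [one]. *)
Definition red (w : seq C) : seq C :=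
  if filter nonunit w is U :: v then U :: v else [:: one].

Lemma red_word w : is_word (red w).
Proof.
rewrite /red; have := filter_all nonunit w.
by case: filter => [|U v] //= h; rewrite /is_word /= h implybT.
Qed.

Definition wordB (w : seq C) : barobj := Barobj (red_word w).

Lemma red_id w : is_word w -> red w = w.
Proof.
rewrite /red; case: w => [|U [|V w]] //=; last first.
  by rewrite /is_word /= => /and3P[-> -> /all_filterP ->].
by move=> _ /=; case: ifP => //= /negbT /nonunitPn ->.
Qed.

Lemma filter_red w : filter nonunit (red w) = filter nonunit w.
Proof.
rewrite /red; have := filter_all nonunit w.
by case: (filter _ w) => [_|U v /all_filterP //]; rewrite /= nonunit1.
Qed.

Lemma red_cat w v : red (red w ++ red v) = red (w ++ v).
Proof. by rewrite {1}/red filter_cat !filter_red -filter_cat. Qed.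

(* Concatenation, with the word [one] as strict unit. *)
Definition tensB (W V : barobj) : barobj := wordB (W ++ V).

Lemma wordB_cat w v : tensB (wordB w) (wordB v) = wordB (w ++ v).
Proof. by apply: eq_barobj; apply: red_cat. Qed.

Lemma wordBK (W : barobj) : wordB W = W.
Proof. by apply: eq_barobj; apply: red_id (wordP W). Qed.

Record brk (W : barobj) := Brk { btree :> tree C; brkP : leaves btree = W }.

Lemma brk_exists (W : barobj) : {t : tree C | leaves t = W}.
Proof.
case: W => [[|U w] hw] //; exists (comb U w); exact: leaves_comb.
Qed.

Definition brk0 (W : barobj) : brk W := Brk (svalP (brk_exists W)).

Definition unit_leaf (t : tree C) : bool :=
  if t is Leaf U then ~~ nonunit U else false.

Definition pair_tree (a b : tree C) : tree C :=
  if unit_leaf a then b else if unit_leaf b then a else Node a b.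

Lemma unit_leafP (t : tree C) : unit_leaf t -> t = Leaf one.
Proof. by case: t => //= U /nonunitPn ->. Qed.

Lemma unit_leafPn (t : tree C) :
  is_word (leaves t) -> ~~ unit_leaf t -> all nonunit (leaves t).
Proof.
case: t => [U _ /=|a b /andP[_]]; first by rewrite negbK => ->.
have [U [w e]] := leaves_cons a; have [V [v f]] := leaves_cons b.
by rewrite /= e f /= size_cat /= addnS implyTb.
Qed.

Lemma pair_treeP (a b : tree C) : is_word (leaves a) -> is_word (leaves b) ->
  leaves (pair_tree a b) = red (leaves a ++ leaves b).
Proof.
move=> ha hb; rewrite /pair_tree.
case: ifPn => [/unit_leafP -> /=|na].
  by rewrite /red /= nonunit1 -/(red _) red_id.
case: ifPn => [/unit_leafP -> /=|nb].
  by rewrite /red filter_cat /= nonunit1 cats0 -/(red _) red_id.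
rewrite red_id // /is_word all_cat !unit_leafPn // implybT andbT.
by rewrite size_cat addn_gt0; case/andP: ha => ->.
Qed.

Lemma ev_pair (a b : tree C) : ev (pair_tree a b) = ev a \ox ev b.
Proof.
rewrite /pair_tree.
case: ifPn => [/unit_leafP -> /=|_]; first by rewrite tens1U.
by case: ifPn => [/unit_leafP -> /=|_] //; rewrite tensU1.
Qed.

Lemma brk_pairP (W V : barobj) (a : brk W) (b : brk V) :
  leaves (pair_tree a b) = tensB W V.
Proof. by rewrite pair_treeP ?brkP //; apply: wordP. Qed.

(* The bracketing (a, b); its object is that of [a] tensored with that of
   [b] ([ev_pair]). *)
Definition brk_pair (W V : barobj) (a : brk W) (b : brk V) : brk (tensB W V) :=
  Brk (brk_pairP a b).

(* Removes the unit leaves; this does not change the object ([ev_prune]). *)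
Fixpoint prune (t : tree C) : tree C :=
  if t is Node a b then pair_tree (prune a) (prune b) else t.

Lemma leaves_prune t : leaves (prune t) = red (leaves t).
Proof.
elim: t => [U|a IHa b IHb] /=; first by rewrite red_id.
by rewrite pair_treeP ?IHa ?IHb ?red_word // red_cat.
Qed.

Lemma ev_prune t : ev (prune t) = ev t.
Proof. by elim: t => //= a IHa b IHb; rewrite ev_pair IHa IHb. Qed.

Section Hom.
Variables W V : barobj.

Definition coh (U : barobj) (a b : brk U) : iso (ev a) (ev b) :=
  Icoh (etrans (brkP a) (esym (brkP b))).

Lemma coh_id (U : barobj) (a : brk U) : coh a a = idm (ev a) :> hom _ _.
Proof. exact: Icoh_id. Qed.

Lemma coh_comp (U : barobj) (a b c : brk U) : coh b c \c coh a b = coh a c.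
Proof. by rewrite Icoh_comp; congr iso_hom; apply: Icoh_irr. Qed.

Definition premor := {p : brk W * brk V & hom (ev p.1) (ev p.2)}.

HB.instance Definition _ := gen_eqMixin premor.
HB.instance Definition _ := gen_choiceMixin premor.

Definition premor_eqv (f1 f2 : premor) : bool :=
  `[< projT2 f2 = coh (projT1 f1).2 (projT1 f2).2 \c projT2 f1
                    \c coh (projT1 f2).1 (projT1 f1).1 >].

Lemma premor_eqv_refl : reflexive premor_eqv.
Proof. by move=> f; apply/asboolP; rewrite !coh_id comp1m compm1. Qed.

Lemma premor_eqv_sub f1 f2 : premor_eqv f1 f2 -> premor_eqv f2 f1.
Proof.
move=> /asboolP e; apply/asboolP; rewrite e comp_conj !coh_comp.
by rewrite !coh_id comp1m compm1.
Qed.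

Lemma premor_eqv_sym : symmetric premor_eqv.
Proof. by move=> f1 f2; apply/idP/idP; apply: premor_eqv_sub. Qed.

Lemma premor_eqv_trans : transitive premor_eqv.
Proof.
move=> f2 f1 f3 /asboolP e /asboolP e'; apply/asboolP; rewrite e' e.
by rewrite comp_conj !coh_comp.
Qed.

Canonical premor_equiv :=
  EquivRel premor_eqv premor_eqv_refl premor_eqv_sym premor_eqv_trans.

Definition homB := {eq_quot premor_equiv}.

HB.instance Definition _ := Choice.on homB.
HB.instance Definition _ := EqQuotient.on homB.

Definition cls (a : brk W) (b : brk V) (f : hom (ev a) (ev b)) : homB :=
  \pi_homB (existT (fun p : brk W * brk V => hom (ev p.1) (ev p.2)) (a, b) f).

(* The unique representative of a class for given bracketings. *)
Definition rep (a : brk W) (b : brk V) (phi : homB) : hom (ev a) (ev b) :=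
  let f := repr phi in
  coh (projT1 f).2 b \c projT2 f \c coh a (projT1 f).1.

Lemma clsK a b a' b' f : rep a' b' (@cls a b f) = coh b b' \c f \c coh a' a.
Proof.
rewrite /rep; case: piP => g /eqmodP /asboolP /= ->.
by rewrite comp_conj !coh_comp.
Qed.

Lemma repK a b phi : cls (rep a b phi) = phi.
Proof.
rewrite /cls -[RHS]reprK; apply/eqmodP/asboolP; rewrite /rep /=.
by rewrite comp_conj !coh_comp !coh_id comp1m compm1.
Qed.

Lemma repcls a b f : rep a b (cls f) = f.
Proof. by rewrite clsK !coh_id comp1m compm1. Qed.

Lemma rep_inj a b : injective (rep a b).
Proof. exact: can_inj (repK a b). Qed.

Lemma rep_coh a b a' b' phi :
  rep a' b' phi = coh b b' \c rep a b phi \c coh a' a.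
Proof. by rewrite -{1}(repK a b phi) clsK. Qed.

Definition zeroB : homB := cls (0 : hom (ev (brk0 W)) (ev (brk0 V))).
Definition addB (f g : homB) : homB :=
  cls (rep (brk0 W) (brk0 V) f + rep (brk0 W) (brk0 V) g).
Definition oppB (f : homB) : homB := cls (- rep (brk0 W) (brk0 V) f).

Lemma addBA : associative addB.
Proof. by move=> f g h; apply: (@rep_inj (brk0 W) (brk0 V)); rewrite !repcls addrA. Qed.

Lemma addBC : commutative addB.
Proof. by move=> f g; apply: (@rep_inj (brk0 W) (brk0 V)); rewrite !repcls addrC. Qed.

Lemma add0B : left_id zeroB addB.
Proof. by move=> f; apply: (@rep_inj (brk0 W) (brk0 V)); rewrite !repcls add0r. Qed.

Lemma addNB : left_inverse zeroB oppB addB.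
Proof. by move=> f; apply: (@rep_inj (brk0 W) (brk0 V)); rewrite !repcls addNr. Qed.

HB.instance Definition _ := GRing.isZmodule.Build homB addBA addBC add0B addNB.

Lemma repD a b (f g : homB) : rep a b (f + g) = rep a b f + rep a b g.
Proof.
rewrite (rep_coh (brk0 W) (brk0 V)) repcls compDr compDl.
by rewrite -!rep_coh.
Qed.

End Hom.

Definition idB (W : barobj) : homB W W := cls (idm (ev (brk0 W))).

Definition compB (W V Z : barobj) (g : homB V Z) (f : homB W V) : homB W Z :=
  cls (rep (brk0 V) (brk0 Z) g \c rep (brk0 W) (brk0 V) f).

Lemma rep_id (W : barobj) (a b : brk W) : rep a b (idB W) = coh a b.
Proof. by rewrite clsK compm1 coh_comp. Qed.

Lemma rep_comp (W V Z : barobj) (a : brk W) (b : brk V) (c : brk Z)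
    (g : homB V Z) (f : homB W V) :
  rep a c (compB g f) = rep b c g \c rep a b f.
Proof.
rewrite clsK (rep_coh (brk0 V) (brk0 Z) b c) (rep_coh (brk0 W) (brk0 V) a b).
have compA5 (Y0 Y1 Y2 Y3 Y4 Y5 Y6 : C) (p : hom Y5 Y6) (q : hom Y4 Y5)
    (x : hom Y3 Y4) (y : hom Y2 Y3) (r : hom Y1 Y2) (t : hom Y0 Y1) :
    (p \c q \c x) \c (y \c r \c t) = p \c (q \c (x \c y) \c r) \c t.
  by rewrite !compA.
by rewrite compA5 coh_comp coh_id compm1.
Qed.

Lemma comp1B W V (f : homB W V) : compB (idB V) f = f.
Proof.
apply: (@rep_inj _ _ (brk0 W) (brk0 V)).
by rewrite (rep_comp _ (brk0 V)) rep_id coh_id comp1m.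
Qed.

Lemma compB1 W V (f : homB W V) : compB f (idB W) = f.
Proof.
apply: (@rep_inj _ _ (brk0 W) (brk0 V)).
by rewrite (rep_comp _ (brk0 W)) rep_id coh_id compm1.
Qed.

Lemma compBA W V Z Y (h : homB Z Y) (g : homB V Z) (f : homB W V) :
  compB h (compB g f) = compB (compB h g) f.
Proof.
apply: (@rep_inj _ _ (brk0 W) (brk0 Y)); rewrite (rep_comp _ (brk0 Z)).
rewrite (rep_comp _ (brk0 V)) (rep_comp _ (brk0 V)) (rep_comp _ (brk0 Z)).
exact: compA.
Qed.

Lemma compBDl W V Z (g g' : homB V Z) (f : homB W V) :
  compB (g + g') f = compB g f + compB g' f.
Proof.
apply: (@rep_inj _ _ (brk0 W) (brk0 Z)).
by rewrite repD !(rep_comp _ (brk0 V)) repD compDl.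
Qed.

Lemma compBDr W V Z (g : homB V Z) (f f' : homB W V) :
  compB g (f + f') = compB g f + compB g f'.
Proof.
apply: (@rep_inj _ _ (brk0 W) (brk0 Z)).
by rewrite repD !(rep_comp _ (brk0 V)) repD compDr.
Qed.

Canonical barCat : abCat := AbCat comp1B compB1 compBA compBDl compBDr.

(* A morphism from the object of [a] tensored with that of [a'] to the object
   of [b] tensored with that of [b'], regarded as a morphism with bracketings
   (a, a') and (b, b'). *)
Definition cls_pair (W W' V V' : barobj) (a : brk W) (a' : brk W')
    (b : brk V) (b' : brk V') (f : hom (ev a \ox ev a') (ev b \ox ev b')) :
    @hom barCat (tensB W W') (tensB V V') :=
  @cls _ _ (brk_pair a a') (brk_pair b b')
    (coe (esym (ev_pair b b')) \c f \c coe (ev_pair a a')).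

Definition tensmB (W V W' V' : barCat) (f : hom W V) (f' : hom W' V') :
    @hom barCat (tensB W W') (tensB V V') :=
  cls_pair (rep (brk0 W) (brk0 V) f \om rep (brk0 W') (brk0 V') f').

Definition PsiB (W V : barCat) : @hom barCat (tensB W V) (tensB V W) :=
  cls_pair (Psi (ev (brk0 W)) (ev (brk0 V))).

Definition oneB : barCat := wordB [::].

Definition powB (A : C) (n : nat) : barCat := wordB (nseq n A).

Definition letter (A : C) : barCat := wordB [:: A].

Lemma brk_letterP (A : C) : leaves (Leaf A) = letter A.
Proof. by rewrite /= red_id. Qed.

Definition brk_letter (A : C) : brk (letter A) := Brk (brk_letterP A).
Definition brk_one : brk oneB := @Brk oneB (Leaf one) erefl.

Lemma tensBA (W V Z : barCat) : tensB (tensB W V) Z = tensB W (tensB V Z).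
Proof.
by rewrite -(wordBK W) -(wordBK V) -(wordBK Z) !wordB_cat catA.
Qed.

End Strict.

Notation "W \bx V" := (tensB W V) : ring_scope.
Notation "f \bm g" := (tensmB f g) : ring_scope.

Record ribbonData (C : braidedCat) := RibbonData {
  car :> C;
  mul : hom (car \ox car) car;
  eta : hom one car;
  rib : hom car car }.

Section RibbonAlgebra.
Variables (C : braidedCat) (A : ribbonData C).

Let L : barCat C := letter A.

Definition mulB : hom (L \bx L) L :=
  @cls C (L \bx L) L (brk_pair (brk_letter A) (brk_letter A)) (brk_letter A)
    (mul A \c coe (ev_pair (brk_letter A) (brk_letter A))).
Definition etaB : hom (oneB C) L :=
  @cls C (oneB C) L (brk_one C) (brk_letter A) (eta A).
Definition ribB : hom L L := @cls C L L (brk_letter A) (brk_letter A) (rib A).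

Definition is_algebra : Prop :=
  [/\ mulB \c (idm L \bm mulB) \c coe (tensBA L L L) = mulB \c (mulB \bm idm L),
      mul A \c (idm (car A) \om eta A) = coe (tensU1 (car A)) &
      mul A \c (eta A \om idm (car A)) = coe (tens1U (car A))].

Definition is_ribbon_algebra : Prop :=
  [/\ is_algebra,
      is_iso (rib A),
      mul A \c (rib A \om rib A) \c Psi (car A) (car A) \c Psi (car A) (car A)
        = rib A \c mul A &
      rib A \c eta A = eta A].

End RibbonAlgebra.

(* The groups and operators of a cocyclic module.  C^n is given as a subgroup,
   [cochain], of a larger group on which the operators make sense (for a ribbon
   algebra, of Hom (A^(n+1), 1)), so that morphisms and cohomology, which only
   involve elements of C^n, can be stated without first proving that the
   operators preserve C^n. *)
Record cocyclicData := CocyclicData {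
  ambient : nat -> zmodType;
  cochain : forall n, zmodClosed (ambient n);
  face : forall n, 'I_n.+2 -> {additive ambient n -> ambient n.+1};
  degen : forall n, 'I_n.+1 -> {additive ambient n.+1 -> ambient n};
  cyc : forall n, {additive ambient n -> ambient n} }.

Record cocyclic_morphism (M N : cocyclicData)
    (f : forall n, ambient M n -> ambient N n) : Prop := {
  cm_cochain : forall n x, x \in cochain M n -> f n x \in cochain N n;
  cm_add : forall n x y, x \in cochain M n -> y \in cochain M n ->
    f n (x + y) = f n x + f n y;
  cm_face : forall n (i : 'I_n.+2) x, x \in cochain M n ->
    f n.+1 (face M i x) = face N i (f n x);
  cm_degen : forall n (i : 'I_n.+1) x, x \in cochain M n.+1 ->
    f n (degen M i x) = degen N i (f n.+1 x);
  cm_cyc : forall n x, x \in cochain M n ->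
    f n (cyc M n x) = cyc N n (f n x) }.

Definition cocyclic_isomorphism (M N : cocyclicData)
    (f : forall n, ambient M n -> ambient N n) : Prop :=
  cocyclic_morphism f /\
  exists g : forall n, ambient N n -> ambient M n,
    [/\ cocyclic_morphism g,
        forall n, {in cochain M n, cancel (f n) (g n)} &
        forall n, {in cochain N n, cancel (g n) (f n)}].

Section Cohomology.
Variables (M : cocyclicData) (S : forall n, zmodClosed (ambient M n)).

Definition diff (n : nat) (x : ambient M n) : ambient M n.+1 :=
  \sum_(i < n.+2) face M i x *~ (-1) ^+ i.

Lemma diff_is_zmod_morphism n : zmod_morphism (@diff n).
Proof.
move=> x y; rewrite /diff -sumrB; apply: eq_bigr => i _.
by rewrite raddfB mulrzBl.
Qed.

HB.instance Definition _ n :=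
  GRing.isZmodMorphism.Build _ _ (@diff n) (@diff_is_zmod_morphism n).

Definition cocycle (n : nat) : {pred ambient M n} :=
  fun x => (x \in S n) && (diff x == 0).

Lemma cocycle_closed n : zmod_closed (@cocycle n).
Proof.
have E x : (x \in @cocycle n) = (x \in S n) && (diff x == 0) by [].
split=> [|x y]; rewrite !E; first by rewrite rpred0 raddf0 eqxx.
move=> /andP[hx /eqP dx] /andP[hy /eqP dy].
by rewrite rpredB // raddfB /= dx dy subrr eqxx.
Qed.

HB.instance Definition _ n :=
  GRing.isZmodClosed.Build _ (@cocycle n) (@cocycle_closed n).

Record cocycles (n : nat) :=
  Cocycle { cocycle_val :> ambient M n; _ : cocycle_val \in @cocycle n }.

HB.instance Definition _ n := [isSub for @cocycle_val n].
HB.instance Definition _ n := [Choice of cocycles n by <:].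
HB.instance Definition _ n := [SubChoice_isSubZmodule of cocycles n by <:].

(* The cocycles of degree n that are images of elements of S^(n-1). *)
Definition coboundary (n : nat) : {pred cocycles n} :=
  match n return {pred cocycles n} with
  | 0%N => fun z => z == 0
  | k.+1 => fun z =>
      `[< exists2 y : ambient M k, y \in S k & cocycle_val z = diff y >]
  end.

Lemma coboundary_closed n : zmod_closed (@coboundary n).
Proof.
case: n => [|k]; split=> [|x y] //.
- by rewrite unfold_in.
- rewrite !unfold_in /=; by move=> /eqP-> /eqP->; rewrite subr0.
- by apply/asboolP; exists 0; rewrite ?rpred0 ?raddf0.
rewrite !unfold_in /= => /asboolP[a ha ea] /asboolP[b hb eb]; apply/asboolP.
by exists (a - b); rewrite ?rpredB // raddfB /= -ea -eb.
Qed.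

HB.instance Definition _ n :=
  GRing.isZmodClosed.Build _ (@coboundary n) (@coboundary_closed n).

Definition coboundaries (n : nat) : zmodClosed (cocycles n) := @coboundary n.

Definition cohomology (n : nat) : zmodType := Quotient.quot (coboundaries n).

Definition cohomology_class (n : nat) (z : cocycles n) : cohomology n :=
  \pi_(Quotient.quot (coboundaries n)) z.

End Cohomology.

Section CyclicCohomology.
Variable M : cocyclicData.

Definition cyclic_pred (n : nat) : {pred ambient M n} :=
  fun x => (x \in cochain M n) && (cyc M n x == x).

Lemma cyclic_pred_closed n : zmod_closed (@cyclic_pred n).
Proof.
have E x : (x \in @cyclic_pred n) = (x \in cochain M n) && (cyc M n x == x).
  by [].
split=> [|x y]; rewrite !E; first by rewrite rpred0 raddf0 eqxx.
move=> /andP[hx /eqP dx] /andP[hy /eqP dy].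
by rewrite rpredB // raddfB dx dy eqxx.
Qed.

HB.instance Definition _ n :=
  GRing.isZmodClosed.Build _ (@cyclic_pred n) (@cyclic_pred_closed n).

Definition cyclic_cochain (n : nat) : zmodClosed (ambient M n) :=
  @cyclic_pred n.

Definition HH (n : nat) : zmodType := cohomology (cochain M) n.
Definition HC (n : nat) : zmodType := cohomology cyclic_cochain n.

End CyclicCohomology.

Definition induced_iso (M N : cocyclicData)
    (f : forall n, ambient M n -> ambient N n)
    (S : forall n, zmodClosed (ambient M n))
    (S' : forall n, zmodClosed (ambient N n)) (n : nat)
    (h : {additive cohomology S n -> cohomology S' n}) : Prop :=
  bijective h /\
  forall z : cocycles S n, exists2 z' : cocycles S' n,
    cocycle_val z' = f n (cocycle_val z) & h (cohomology_class z) = cohomology_class z'.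

Section Precomp.
Variables (C : abCat) (U V W : C) (f : hom U V).

Definition precomp (phi : hom V W) : hom U W := phi \c f.

Lemma precomp_is_zmod_morphism : zmod_morphism precomp.
Proof. by move=> g g'; exact: compBl. Qed.

HB.instance Definition _ :=
  GRing.isZmodMorphism.Build _ _ precomp precomp_is_zmod_morphism.

End Precomp.

Section RibbonCocyclic.
Variables (C : braidedCat) (A : ribbonData C).

Let L : barobj C := letter A.
Let P (n : nat) : barobj C := powB A n.

Lemma nseq_split (x : C) k i n : (i <= n)%N ->
  (nseq i x ++ nseq k x) ++ nseq (n - i) x = nseq (k + n) x.
Proof. by move=> le_in; rewrite -catA -!nseqD addnCA subnKC. Qed.

Lemma face_src n (i : 'I_n.+1) : P n.+2 = (P i \bx (L \bx L)) \bx P (n - i).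
Proof.
rewrite /L /P /letter /powB !wordB_cat; congr wordB.
by symmetry; apply: (nseq_split _ 2); rewrite -ltnS.
Qed.

Lemma face_tgt n (i : 'I_n.+1) : (P i \bx L) \bx P (n - i) = P n.+1.
Proof.
rewrite /L /P /letter /powB !wordB_cat; congr wordB.
by apply: (nseq_split _ 1); rewrite -ltnS.
Qed.

Lemma powB_recl n : L \bx P n = P n.+1.
Proof. by rewrite /L /P /letter /powB wordB_cat. Qed.

Lemma powB_recr n : P n \bx L = P n.+1.
Proof.
rewrite /L /P /letter /powB wordB_cat; congr wordB.
by rewrite -[[:: _]]/(nseq 1 _) -nseqD addn1.
Qed.

Lemma last_mid n : L \bx P n.+1 = (L \bx L) \bx P n.
Proof. by rewrite tensBA (powB_recl n). Qed.

Lemma degen_src n (i : 'I_n.+1) : P n.+1 = (P i.+1 \bx oneB C) \bx P (n - i).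
Proof.
rewrite /P /powB /oneB !wordB_cat cats0 -nseqD addSn subnKC //.
by rewrite -ltnS.
Qed.

Lemma degen_tgt n (i : 'I_n.+1) : (P i.+1 \bx L) \bx P (n - i) = P n.+2.
Proof.
rewrite /L /P /letter /powB !wordB_cat; congr wordB; rewrite -subSS.
by apply: (nseq_split _ 1); rewrite ltn_ord.
Qed.

Definition twist n : hom (P n \bx L) (L \bx P n) :=
  (ribB A \bm idm (P n)) \c PsiB (P n) L.

Definition face_inner n (i : 'I_n.+1) : hom (P n.+2) (P n.+1) :=
  coe (face_tgt i) \c ((idm (P i) \bm mulB A) \bm idm (P (n - i)))
    \c coe (face_src i).

Definition face_last n : hom (P n.+2) (P n.+1) :=
  coe (powB_recl n) \c (mulB A \bm idm (P n)) \c coe (last_mid n)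
    \c twist n.+1 \c coe (esym (powB_recr n.+1)).

(* d_i^(n+1); the index [ord_max] is i = n + 1. *)
Definition face_mor n (i : 'I_n.+2) : hom (P n.+2) (P n.+1) :=
  if unlift ord_max i is Some j then face_inner j else face_last n.

Definition degen_mor n (i : 'I_n.+1) : hom (P n.+1) (P n.+2) :=
  coe (degen_tgt i) \c ((idm (P i.+1) \bm etaB A) \bm idm (P (n - i)))
    \c coe (degen_src i).

Definition cyc_mor n : hom (P n.+1) (P n.+1) :=
  (coe (powB_recl n) \c twist n \c coe (esym (powB_recr n))) *~ (-1) ^+ n.

Definition ribbon_pred (n : nat) : {pred hom (P n.+1) (oneB C)} :=
  fun phi => phi \c pow_end (cyc_mor n) n.+1 == phi.

Lemma ribbon_pred_closed n : zmod_closed (@ribbon_pred n).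
Proof.
split=> [|x y]; rewrite !unfold_in; first by rewrite comp0m eqxx.
by move=> /eqP dx /eqP dy; rewrite compBl dx dy eqxx.
Qed.

HB.instance Definition _ n :=
  GRing.isZmodClosed.Build _ (@ribbon_pred n) (@ribbon_pred_closed n).

Definition ribbon_cocyclic : cocyclicData := {|
  ambient := fun n => hom (P n.+1) (oneB C);
  cochain := fun n => @ribbon_pred n;
  face := fun n i => precomp (W := oneB C) (face_mor i);
  degen := fun n i => precomp (W := oneB C) (degen_mor i);
  cyc := fun n => precomp (W := oneB C) (cyc_mor n) |}.

End RibbonCocyclic.

Record abFunctor (C D : abCat) := AbFunctor {
  fobj :> C -> D;
  fmor : forall U V : C, hom U V -> hom (fobj U) (fobj V);
  fmor_id : forall U : C, fmor (idm U) = idm (fobj U);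
  fmor_comp : forall (U V W : C) (g : hom V W) (f : hom U V),
    fmor (g \c f) = fmor g \c fmor f;
  fmorD : forall (U V : C) (f g : hom U V), fmor (f + g) = fmor f + fmor g }.

Arguments fmor {C D} a {U V} f.

Definition fid (C : abCat) : abFunctor C C :=
  @AbFunctor C C (fun U => U) (fun U V f => f)
    (fun _ => erefl) (fun _ _ _ _ _ => erefl) (fun _ _ _ _ => erefl).

Section FunctorComp.
Variables (C D E : abCat) (G : abFunctor D E) (F : abFunctor C D).

Lemma fcomp_id (U : C) : fmor G (fmor F (idm U)) = idm (G (F U)).
Proof. by rewrite !fmor_id. Qed.

Lemma fcomp_comp (U V W : C) (g : hom V W) (f : hom U V) :
  fmor G (fmor F (g \c f)) = fmor G (fmor F g) \c fmor G (fmor F f).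
Proof. by rewrite !fmor_comp. Qed.

Lemma fcompD (U V : C) (f g : hom U V) :
  fmor G (fmor F (f + g)) = fmor G (fmor F f) + fmor G (fmor F g).
Proof. by rewrite !fmorD. Qed.

Definition fcomp : abFunctor C E :=
  @AbFunctor C E (fun U => G (F U)) (fun U V f => fmor G (fmor F f))
    fcomp_id fcomp_comp fcompD.

End FunctorComp.

(* Strict invertibility: equality of functors is Leibniz equality of the
   records, i.e. equality of the maps on objects and on morphisms. *)
Definition invertible (C D : abCat) (F : abFunctor C D) : Prop :=
  exists G : abFunctor D C, fcomp G F = fid C /\ fcomp F G = fid D.

Record tensorFunctor (C D : braidedCat) := TensorFunctor {
  tfun :> abFunctor C D;
  tfun1 : tfun one = one;
  tF : forall U V : C, iso (tfun U \ox tfun V) (tfun (U \ox V));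
  tF_nat : forall (U U' V V' : C) (f : hom U U') (g : hom V V'),
    tF U' V' \c (fmor tfun f \om fmor tfun g) = fmor tfun (f \om g) \c tF U V;
  tFU1 : forall (U : C) (e : tfun U \ox tfun one = tfun (U \ox one)),
    iso_hom (tF U one) = coe e;
  tF1U : forall (U : C) (e : tfun one \ox tfun U = tfun (one \ox U)),
    iso_hom (tF one U) = coe e;
  tF_Phi : forall U V W : C,
    fmor tfun (Phi U V W) \c tF U (V \ox W) \c (idm (tfun U) \om tF V W) =
    tF (U \ox V) W \c (tF U V \om idm (tfun W))
      \c Phi (tfun U) (tfun V) (tfun W);
  tF_Psi : forall U V : C,
    fmor tfun (Psi U V) \c tF U V = tF V U \c Psi (tfun U) (tfun V) }.

Section BarFunctor.
Variables (C D : braidedCat) (T : tensorFunctor C D).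

(* The leaves of [tree_map T t] are the T(U_i). *)
Fixpoint S_iso (t : tree C) : iso (ev (tree_map T t)) (T (ev t)) :=
  match t return iso (ev (tree_map T t)) (T (ev t)) with
  | Leaf U => iid (T U)
  | Node a b => icomp (tF T (ev a) (ev b)) (itens (S_iso a) (S_iso b))
  end.

(* [T] may send a letter to the unit, and such letters disappear. *)
Definition barT_obj (W : barobj C) : barobj D := wordB (map T W).

Lemma brk_mapP (W : barobj C) (a : brk W) :
  leaves (prune (tree_map T a)) = barT_obj W.
Proof. by rewrite leaves_prune leaves_map brkP. Qed.

Definition brk_map (W : barobj C) (a : brk W) : brk (barT_obj W) :=
  Brk (brk_mapP a).

Definition barT (W V : barobj C) (f : hom W V) :
    hom (barT_obj W) (barT_obj V) :=
  let a := brk0 W in let b := brk0 V in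
  @cls D (barT_obj W) (barT_obj V) (brk_map a) (brk_map b)
    (coe (esym (ev_prune (tree_map T b))) \c iso_inv (S_iso b)
       \c fmor T (rep a b f) \c S_iso a \c coe (ev_prune (tree_map T a))).

Lemma barT_wordB (w : seq C) : barT_obj (wordB w) = wordB (map T w).
Proof.
have key (v : seq C) : filter (@nonunit D) (map T v) =
    filter (@nonunit D) (map T (filter (@nonunit C) v)).
  elim: v => //= U v IH; case: (boolP (nonunit U)) => [_|/nonunitPn ->] /=.
    by rewrite IH.
  by rewrite tfun1 nonunit1.
by apply: eq_barobj; rewrite /= /red key filter_red -key.
Qed.

Lemma barT_powB (A : C) n : barT_obj (powB A n) = powB (T A) n.
Proof. by rewrite barT_wordB map_nseq. Qed.

Lemma barT_letter (A : C) : barT_obj (letter A) = letter (T A).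
Proof. exact: barT_wordB. Qed.

Lemma barT_letter2 (A : C) :
  barT_obj (letter A \bx letter A) = letter (T A) \bx letter (T A).
Proof. by rewrite !wordB_cat barT_wordB. Qed.

Lemma barT_one : barT_obj (oneB C) = oneB D.
Proof. by rewrite barT_wordB. Qed.

Definition ribbon_image (A : ribbonData C) : ribbonData D := {|
  car := T (car A);
  mul := fmor T (mul A) \c tF T (car A) (car A);
  eta := fmor T (eta A) \c coe (esym (tfun1 T));
  rib := fmor T (rib A) |}.

Definition barT_cochain (A : ribbonData C) (n : nat)
    (phi : ambient (ribbon_cocyclic A) n) :
    ambient (ribbon_cocyclic (ribbon_image A)) n :=
  coe barT_one \c barT phi \c coe (esym (barT_powB A n.+1)).

End BarFunctor.

(* Main.v *)
Require Import Defs.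
From HB Require Import structures.
From mathcomp Require Import all_boot all_algebra.
From mathcomp Require Import generic_quotient ring_quotient.
From mathcomp.classical Require Import boolp.
(* Again, so that [hom] means morphisms and not linear maps. *)
Import Defs.

(** Morphisms of the strict extension are classes of morphisms between bracketed
    words, so everything rests on one compatibility: the isomorphisms [S_iso]
    intertwine the coherence isomorphisms of the two categories ([S_Ucoh]).
    Words of the strict extension contain no unit letter, but [T] may send a
    letter to the unit, and such letters are erased from the image; coherence
    therefore has to be available between any two bracketings whose words agree
    after erasure of the units.  These isomorphisms, [Ucoh], are compatible with
    tensor products, associators and strict units.  Any two such bracketings are
    linked by a chain of associativity and unit moves ([same_word_coheq]), and
    along each move the compatibility of [S_iso] with [Ucoh] is one of the axioms
    of a tensor functor.

    It follows that if a morphism [f] between the objects of two bracketings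
    represents [phi], then S^-1 T(f) S represents the image of [phi]
    ([represents_barT]).  Now f |-> S^-1 T(f) S commutes with composition and
    tensor products and preserves the braiding, because [S_iso] of a pair is built
    from [tF].  So the functor between the strict extensions is, up to the
    identification of equal objects, a strict braided monoidal functor; this is
    the content of the closure lemmas for the relation [barT_img].  It sends
    product, unit and ribbon structure of the algebra to those of its image,
    hence the structure morphisms of the first cocyclic module, which are
    composites and tensor products of these, to those of the second, and
    precomposition with them is preserved.  Associativity of the image algebra,
    which is an equation in the strict extension, is transported the same way.

    An invertible functor is bijective on morphisms ([invertible_bij]); hence so
    is conjugation by [S_iso], and so is the map on cochains.  A bijective
    additive map that commutes with the faces and both preserves and reflects a
    family of subgroups induces isomorphisms between the cohomologies of these
    subgroups ([induced_iso_exists]); Hochschild and cyclic cohomology are the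
    cases of all cochains and of the cyclic ones. *)

Set Implicit Arguments.
Unset Strict Implicit.
Unset Printing Implicit Defensive.

Import GRing.Theory.
Local Open Scope ring_scope.
Local Open Scope quotient_scope.

(** * Coherence in the presence of unit letters *)

Lemma comp_cancel (C : abCat) (U0 U1 U2 U3 U4 U5 : C) (k : hom U4 U5)
    (g : hom U3 U4) (h' : hom U2 U3) (h : hom U3 U2) (f : hom U1 U3)
    (i : hom U0 U1) :
  h' \c h = idm U3 -> (k \c g \c h') \c (h \c f \c i) = k \c (g \c f) \c i.
Proof.
by move=> hK; rewrite !compA (compA1 _ hK) compm1.
Qed.

Section CoeLemmas.
Variable C : braidedCat.

Lemma tens_coe (U U' V V' : C) (e : U = U') (f : V = V')
    (g : U \ox V = U' \ox V') : coe e \om coe f = coe g.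
Proof. by case: U' / e g; case: V' / f => g; rewrite !coe_id tensm_id. Qed.

(** The strict unit law for objects that are only provably equal to the unit, as
    the image of the unit under a tensor functor is. *)
Lemma tens1_coe (X X' U V : C) (f : hom U V) (eX : X = one) (eX' : X' = one)
    (e : X = X') (eU : X \ox U = U) (eV : X' \ox V = V) :
  coe eV \c (coe e \om f) = f \c coe eU.
Proof.
case: X' / e eX' eV => _; move/esym: eX => eX.
by case: X / eX eU => eU eV; apply: tens1m.
Qed.

Lemma tens_coe1 (X X' U V : C) (f : hom U V) (eX : X = one) (eX' : X' = one)
    (e : X = X') (eU : U \ox X = U) (eV : V \ox X' = V) :
  coe eV \c (f \om coe e) = f \c coe eU.
Proof.
case: X' / e eX' eV => _; move/esym: eX => eX.
by case: X / eX eU => eU eV; apply: tensm1.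
Qed.

Lemma Phi1_coe (U V W : C) (e : U \ox (V \ox W) = (U \ox V) \ox W) :
  [\/ U = one, V = one | W = one] -> iso_hom (Phi U V W) = coe e.
Proof.
case=> /esym h; [case: U / h e | case: V / h e | case: W / h e] => e.
- exact: Phi1UV.
- exact: PhiU1V.
- exact: PhiUV1.
Qed.

Lemma tensm_comp3 (U0 U1 U2 U3 V0 V1 V2 V3 : C)
    (k : hom U2 U3) (g : hom U1 U2) (f : hom U0 U1)
    (k' : hom V2 V3) (g' : hom V1 V2) (f' : hom V0 V1) :
  (k \c g \c f) \om (k' \c g' \c f') =
  (k \om k') \c (g \om g') \c (f \om f').
Proof. by rewrite !tensm_comp. Qed.

Lemma tensm_split_l (U U' U'' V V' : C) (g : hom U' U'')
    (f : hom U U') (h : hom V V') :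
  (g \c f) \om h = (g \om idm V') \c (f \om h).
Proof. by rewrite -tensm_comp comp1m. Qed.

Lemma tensm_split_r (U U' V V' V'' : C) (g : hom V' V'')
    (f : hom V V') (h : hom U U') :
  h \om (g \c f) = (idm U' \om g) \c (h \om f).
Proof. by rewrite -tensm_comp comp1m. Qed.

End CoeLemmas.

Section UnitCoherence.
Variable C : braidedCat.
Implicit Types a b c s t : tree C.

Lemma Icoh_coe s t (e : s = t) (e' : leaves s = leaves t)
    (f : ev s = ev t) : iso_hom (Icoh e') = coe f.
Proof. by case: t / e e' f => e' f; rewrite Icoh_id coe_id. Qed.

(** Moving to the bracketing to the right consumes exactly one inverse
    associator more on the right-hand tree than on the left-hand one; the two
    right bracketings are convertible. *)
Lemma Icoh_Phi_tree a b c
    (e : leaves (Node a (Node b c)) = leaves (Node (Node a b) c)) :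
  iso_hom (Icoh e) = Phi (ev a) (ev b) (ev c).
Proof.
pose p := rcomb_iso (Node (Node a b) c).
rewrite -[RHS]comp1m -(isoK p) -compA; congr (_ \c _).
(* Both trees have the same [rcomb] by computation, so the cast is trivial. *)
rewrite /= coe_id comp1m !compA.
rewrite -!(compA (iso_hom (graft_iso a _))) -tensm_id.
congr (_ \c _).
rewrite tensm1_comp -!compA; congr (_ \c _).
by rewrite -Phi_nat compA isoK comp1m.
Qed.

Lemma unit_leaf_red t : is_word (leaves t) ->
  unit_leaf t = `[< leaves t = [:: one] >].
Proof.
move=> wt; apply/idP/asboolP => [/unit_leafP -> //|].
case: t wt => [U _ [->]|a b _ /=]; first by rewrite /= nonunit1.
have [U [w ->]] := leaves_cons a; have [V [v ->]] := leaves_cons b.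
by case: w.
Qed.

(** When a factor is the unit, [pair_tree] drops it and the claim is the strict
    unit law; otherwise it is [Icoh_tens]. *)
Lemma Icoh_pair a b a' b' (wa : is_word (leaves a)) (wa' : is_word (leaves a'))
    (wb : is_word (leaves b)) (wb' : is_word (leaves b'))
    (ea : leaves a = leaves a') (eb : leaves b = leaves b')
    (e : leaves (pair_tree a b) = leaves (pair_tree a' b'))
    (f : ev (pair_tree a b) = ev a \ox ev b)
    (f' : ev (pair_tree a' b') = ev a' \ox ev b') :
  coe f' \c Icoh e = (Icoh ea \om Icoh eb) \c coe f.
Proof.
have ua : unit_leaf a = unit_leaf a' by rewrite !unit_leaf_red // ea.
have ub : unit_leaf b = unit_leaf b' by rewrite !unit_leaf_red // eb.
move: e f f'; rewrite /pair_tree -ua -ub.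
case: ifPn => [h|_].
  move: (h); rewrite ua => /unit_leafP/esym ta'; move/unit_leafP/esym: h => ta {ua}.
  case: a / ta wa ea; case: a' / ta' wa' => _ _ ea e f f'.
  rewrite Icoh_id (Icoh_irr e eb) -[idm _]/(coe (erefl (one : C))).
  have := @tens1_coe C one one _ _ (Icoh eb) erefl erefl erefl (esym f) (esym f').
  move/(congr1 (fun x => coe f' \c x \c coe f)).
  by rewrite !compA coeVK comp1m -!compA coeK compm1.
case: ifPn => [h|_].
  move: (h); rewrite ub => /unit_leafP/esym tb'; move/unit_leafP/esym: h => tb {ub}.
  case: b / tb wb eb; case: b' / tb' wb' => _ _ eb e f f'.
  rewrite Icoh_id (Icoh_irr e ea) -[idm _]/(coe (erefl (one : C))).
  have := @tens_coe1 C one one _ _ (Icoh ea) erefl erefl erefl (esym f) (esym f').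
  move/(congr1 (fun x => coe f' \c x \c coe f)).
  by rewrite !compA coeVK comp1m -!compA coeK compm1.
by move=> e f f'; rewrite !coe_id comp1m compm1; apply: Icoh_tens.
Qed.

Lemma pair_treeA a b c : is_word (leaves a) -> is_word (leaves b) ->
  is_word (leaves c) ->
  [|| unit_leaf a, unit_leaf b | unit_leaf c] ->
  pair_tree a (pair_tree b c) = pair_tree (pair_tree a b) c.
Proof.
move=> wa wb wc; rewrite /pair_tree.
by case: (ifPn (unit_leaf a)) => // ua; case: (ifPn (unit_leaf b)) => // ub;
  case: (ifPn (unit_leaf c)) => //= uc; rewrite ?(negbTE ua) ?ub ?(negbTE ub) //.
Qed.

(** When a factor is the unit, the two trees coincide and the associator is an
    identity; otherwise it is [Icoh_Phi_tree]. *)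
Lemma Icoh_pairA a b c (wa : is_word (leaves a)) (wb : is_word (leaves b))
    (wc : is_word (leaves c))
    (e : leaves (pair_tree a (pair_tree b c)) =
         leaves (pair_tree (pair_tree a b) c))
    (f : ev (pair_tree a (pair_tree b c)) = ev a \ox (ev b \ox ev c))
    (f' : ev (pair_tree (pair_tree a b) c) = (ev a \ox ev b) \ox ev c) :
  coe f' \c Icoh e = Phi (ev a) (ev b) (ev c) \c coe f.
Proof.
case: (boolP [|| unit_leaf a, unit_leaf b | unit_leaf c]) => [u|].
  have q := pair_treeA wa wb wc u.
  have g := etrans (esym f) (etrans (congr1 (@ev C) q) f').
  rewrite (Icoh_coe q _ (congr1 (@ev C) q)) coe_coe (Phi1_coe g).
    by rewrite coe_coe; apply: coe_irr.
  by case/or3P: u => /unit_leafP ->; [apply: Or31|apply: Or32|apply: Or33].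
rewrite !negb_or => /and3P[ua ub uc].
move: e f f'; rewrite /pair_tree (negbTE ua) (negbTE ub) (negbTE uc) /= => e f f'.
by rewrite !(coe_id f, coe_id f') comp1m compm1; apply: Icoh_Phi_tree.
Qed.

Lemma prune_word t : is_word (leaves t) -> prune t = t.
Proof.
elim: t => //= a IHa b IHb w.
have : all (@nonunit C) (leaves a ++ leaves b).
  move: w => /andP[_]; have [U [u ->]] := leaves_cons a.
  by have [V [v ->]] := leaves_cons b; rewrite size_cat addnS.
rewrite all_cat => /andP[ha hb].
have word_of d : all (@nonunit C) (leaves d) -> is_word (leaves d).
  by move=> hd; rewrite /is_word hd implybT andbT; have [? [? ->]] := leaves_cons d.
have nu d : all (@nonunit C) (leaves d) -> unit_leaf d = false.
  by case: d => //= U; rewrite andbT => ->.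
by rewrite IHa ?IHb ?word_of // /pair_tree !nu.
Qed.

(** Erasing unit letters is what the strict extension does to words, so this is
    the relation along which coherence isomorphisms are needed. *)
Definition same_word s t : Prop := red (leaves s) = red (leaves t).

Lemma prune_leaves s t : same_word s t -> leaves (prune s) = leaves (prune t).
Proof. by rewrite !leaves_prune. Qed.

Lemma prune_is_word t : is_word (leaves (prune t)).
Proof. by rewrite leaves_prune red_word. Qed.

Fact Ucoh_key : unit. Proof. exact: tt. Qed.

(** Locked: its unfolding is itself a composite, which rewriting with
    associativity would take apart. *)
Definition Ucoh s t (e : same_word s t) : hom (ev s) (ev t) :=
  locked_with Ucoh_key
    (coe (ev_prune t) \c Icoh (prune_leaves e) \c coe (esym (ev_prune s))).

Lemma UcohE s t (e : same_word s t) :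
  Ucoh e = coe (ev_prune t) \c Icoh (prune_leaves e) \c coe (esym (ev_prune s)).
Proof. by rewrite /Ucoh unlock. Qed.

Lemma Ucoh_irr s t (e e' : same_word s t) : Ucoh e = Ucoh e'.
Proof. by rewrite (Prop_irrelevance e e'). Qed.

Lemma Ucoh_comp r s t (e1 : same_word r s) (e2 : same_word s t)
  (e3 : same_word r t) : Ucoh e2 \c Ucoh e1 = Ucoh e3.
Proof.
rewrite !UcohE comp_cancel ?coeK // Icoh_comp.
by congr (_ \c _ \c _); congr iso_hom; apply: Icoh_irr.
Qed.

Lemma Ucoh_coe s t (e : same_word s t) (q : prune s = prune t)
  (f : ev s = ev t) : Ucoh e = coe f.
Proof.
by rewrite !UcohE (Icoh_coe q _ (congr1 (@ev C) q)) !coe_coe; apply: coe_irr.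
Qed.

Lemma Ucoh_id t (e : same_word t t) : Ucoh e = idm (ev t).
Proof. by rewrite (Ucoh_coe e erefl erefl). Qed.

Lemma Ucoh_Icoh s t (e : same_word s t) (e' : leaves s = leaves t) :
  is_word (leaves s) -> Ucoh e = Icoh e'.
Proof.
move=> ws; have wt : is_word (leaves t) by rewrite -e'.
rewrite !UcohE; move: (ev_prune s) (ev_prune t) (prune_leaves e).
rewrite !prune_word // => f g h; rewrite !coe_id comp1m compm1.
by congr iso_hom; apply: Icoh_irr.
Qed.

Lemma Ucoh_tens a b a' b' (ea : same_word a a') (eb : same_word b b')
    (e : same_word (Node a b) (Node a' b')) : Ucoh e = Ucoh ea \om Ucoh eb.
Proof.
have f (x y : tree C) : ev (pair_tree (prune x) (prune y)) = ev (prune x) \ox ev (prune y).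
  exact: ev_pair.
have g (x y : tree C) : ev (prune x) \ox ev (prune y) = ev x \ox ev y.
  by rewrite !ev_prune.
have h (x y : tree C) : ev x \ox ev y = ev (prune x) \ox ev (prune y).
  by rewrite !ev_prune.
rewrite !UcohE tensm_comp3 (tens_coe _ _ (g a' b')) (tens_coe _ _ (h a b)).
rewrite (coe_irr (ev_prune (Node a' b')) (etrans (f a' b') (g a' b'))).
rewrite -coe_coe -(compA (coe (g _ _)) (coe (f _ _))).
rewrite (Icoh_pair (prune_is_word _) (prune_is_word _) (prune_is_word _)
  (prune_is_word _) (prune_leaves ea) (prune_leaves eb) _ (f a b)).
rewrite (compA (coe (g _ _))) -(compA _ (coe (f a b))) coe_coe.
by congr (_ \c _); apply: coe_irr.
Qed.

Lemma Ucoh_Phi a b c (e : same_word (Node a (Node b c)) (Node (Node a b) c)) :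
  Ucoh e = Phi (ev a) (ev b) (ev c).
Proof.
have fr : ev (prune (Node a (Node b c))) =
  ev (prune a) \ox (ev (prune b) \ox ev (prune c)) by rewrite /= !ev_pair.
have fl : ev (prune (Node (Node a b) c)) =
  (ev (prune a) \ox ev (prune b)) \ox ev (prune c) by rewrite /= !ev_pair.
have gl : (ev (prune a) \ox ev (prune b)) \ox ev (prune c) =
  (ev a \ox ev b) \ox ev c by rewrite !ev_prune.
have gr : ev a \ox (ev b \ox ev c) =
  ev (prune a) \ox (ev (prune b) \ox ev (prune c)) by rewrite !ev_prune.
rewrite !UcohE (coe_irr (ev_prune _) (etrans fl gl)) -coe_coe -(compA (coe gl) (coe fl)).
rewrite (Icoh_pairA (prune_is_word _) (prune_is_word _) (prune_is_word _) _ fr).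
rewrite (compA (coe gl)) -(compA _ (coe fr)) coe_coe (coe_irr _ gr).
move: gl gr; rewrite !ev_prune => gl gr.
by rewrite !coe_id comp1m compm1.
Qed.

(** The moves along which compatibility with [Ucoh] can be checked one axiom of
    a tensor functor at a time; see [S_Ucoh]. *)
Inductive coheq : tree C -> tree C -> Prop :=
| coheq_refl t : coheq t t
| coheq_sym s t : coheq s t -> coheq t s
| coheq_trans r s t : coheq r s -> coheq s t -> coheq r t
| coheq_node a a' b b' :
    coheq a a' -> coheq b b' -> coheq (Node a b) (Node a' b')
| coheq_assoc a b c : coheq (Node a (Node b c)) (Node (Node a b) c)
| coheq_unitl t : coheq (Node (Leaf one) t) t
| coheq_unitr t : coheq (Node t (Leaf one)) t.

Lemma same_word_node a a' b b' : same_word a a' -> same_word b b' ->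
  same_word (Node a b) (Node a' b').
Proof.
by move=> ea eb; rewrite /same_word /= -red_cat ea eb red_cat.
Qed.

Lemma same_word_assoc a b c :
  same_word (Node a (Node b c)) (Node (Node a b) c).
Proof. by rewrite /same_word /= catA. Qed.

Lemma same_word_unitl t : same_word (Node (Leaf one) t) t.
Proof. by rewrite /same_word /= /red /= nonunit1. Qed.

Lemma same_word_unitr t : same_word (Node t (Leaf one)) t.
Proof. by rewrite /same_word /= /red filter_cat /= nonunit1 cats0. Qed.

Lemma coheq_word s t : coheq s t -> same_word s t.
Proof.
elim=> {s t} //.
- by move=> r s t _ e1 _ e2; apply: etrans e1 e2.
- by move=> a a' b b' _ ea _ eb; apply: same_word_node.
- exact: same_word_assoc.
- exact: same_word_unitl.
- exact: same_word_unitr.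
Qed.

Lemma coheq_prune t : coheq t (prune t).
Proof.
elim: t => [U|a IHa b IHb]; first exact: coheq_refl.
apply: coheq_trans (coheq_node IHa IHb) _ => /=; rewrite /pair_tree.
case: ifP => [/unit_leafP ->|_]; first exact: coheq_unitl.
case: ifP => [/unit_leafP ->|_]; first exact: coheq_unitr.
exact: coheq_refl.
Qed.

Lemma coheq_graft t s : coheq (Node t s) (graft t s).
Proof.
elim: t s => [U|a IHa b IHb] s /=; first exact: coheq_refl.
apply: coheq_trans (coheq_sym (coheq_assoc a b s)) _.
by apply: coheq_trans (coheq_node (coheq_refl a) (IHb s)) _.
Qed.

Lemma coheq_rcomb t : coheq t (rcomb t).
Proof.
elim: t => [U|a _ b IHb] /=; first exact: coheq_refl.
by apply: coheq_trans (coheq_node (coheq_refl a) IHb) (coheq_graft _ _).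
Qed.

(** Mac Lane's normal form argument: erase the units, then bracket to the right. *)
Lemma same_word_coheq s t : same_word s t -> coheq s t.
Proof.
move=> e; apply: coheq_trans (coheq_prune s) _.
apply: coheq_trans (coheq_sym (coheq_prune t)).
apply: coheq_trans (coheq_rcomb _) _.
by rewrite (eq_rcomb (prune_leaves e)); apply/coheq_sym/coheq_rcomb.
Qed.

End UnitCoherence.

(** * Representatives of morphisms of the strict extension *)

Section Represents.
Variable C : braidedCat.
Implicit Types (s t r : tree C) (W V Z : barobj C).

Definition brackets t W : Prop := red (leaves t) = W.

Lemma brackets_brk W (a : brk W) : brackets a W.
Proof. by rewrite /brackets brkP red_id // wordP. Qed.

Lemma brackets_same s t W : brackets s W -> brackets t W -> same_word s t.
Proof. by rewrite /brackets /same_word => -> ->. Qed.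

(** Extends [rep] from bracketings of the word itself to trees that may contain
    unit letters, such as [tree_map T t] or the pair of two bracketings; on such
    trees tensor products of morphisms need no cast. *)
Definition represents s t W V (f : hom (ev s) (ev t)) (phi : @hom (barCat C) W V)
    : Prop :=
  exists (hs : same_word s (brk0 W)) (ht : same_word (brk0 V) t),
    f = Ucoh ht \c rep (brk0 W) (brk0 V) phi \c Ucoh hs.

Lemma same_word_sym s t : same_word s t -> same_word t s.
Proof. exact: esym. Qed.

Lemma Ucoh_K s t (e : same_word s t) (e' : same_word t s) :
  Ucoh e' \c Ucoh e = idm _.
Proof. by rewrite (Ucoh_comp _ _ erefl) Ucoh_id. Qed.

Lemma coh_Ucoh W (a b : brk W) (e : same_word a b) :
  coh a b = Ucoh e :> hom _ _.
Proof.
by rewrite (Ucoh_Icoh _ (etrans (brkP a) (esym (brkP b)))) // brkP wordP.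
Qed.

(** The coherence isomorphisms between bracketings of a word without units are
    particular [Ucoh]. *)
Lemma represents_rep W V (a : brk W) (b : brk V) (phi : @hom (barCat C) W V) :
  represents (rep a b phi) phi.
Proof.
have ha := brackets_same (brackets_brk a) (brackets_brk (brk0 W)).
have hb := brackets_same (brackets_brk (brk0 V)) (brackets_brk b).
exists ha, hb.
by rewrite (rep_coh (brk0 W) (brk0 V)) (coh_Ucoh hb) (coh_Ucoh ha).
Qed.

Lemma represents_cls W V (a : brk W) (b : brk V) (f : hom (ev a) (ev b)) :
  represents f (cls f : @hom (barCat C) W V).
Proof. by have := represents_rep a b (cls f); rewrite repcls. Qed.

Lemma represents_move s t s' t' W V (f : hom (ev s) (ev t))
    (phi : @hom (barCat C) W V) (es : same_word s' s) (et : same_word t t') :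
  represents f phi -> represents (Ucoh et \c f \c Ucoh es) phi.
Proof.
case=> hs [ht ->]; exists (etrans es hs), (etrans ht et).
rewrite comp_conj.
by rewrite !(Ucoh_comp _ _ (etrans ht et), Ucoh_comp _ _ (etrans es hs)).
Qed.

Lemma represents_ex s t W V (phi : @hom (barCat C) W V) :
  brackets s W -> brackets t V -> exists f : hom (ev s) (ev t), represents f phi.
Proof.
move=> hs ht.
have es := brackets_same hs (brackets_brk (brk0 W)).
have et := brackets_same (brackets_brk (brk0 V)) ht.
by eexists; exists es, et.
Qed.

Lemma represents_fun s t W V (f g : hom (ev s) (ev t))
    (phi : @hom (barCat C) W V) :
  represents f phi -> represents g phi -> f = g.
Proof.
case=> hs [ht ->] [hs' [ht' ->]].
by rewrite (Ucoh_irr hs hs') (Ucoh_irr ht ht').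
Qed.

Lemma represents_inj s t W V (f : hom (ev s) (ev t))
    (phi psi : @hom (barCat C) W V) :
  represents f phi -> represents f psi -> phi = psi.
Proof.
case=> hs [ht ->] [hs' [ht' e]].
apply: (@rep_inj _ _ _ (brk0 W) (brk0 V)).
have := congr1 (fun x =>
  Ucoh (same_word_sym ht) \c x \c Ucoh (same_word_sym hs)) e.
rewrite (Ucoh_irr hs' hs) (Ucoh_irr ht' ht) [LHS]comp_conj [RHS]comp_conj.
rewrite !Ucoh_K.
by rewrite !comp1m !compm1.
Qed.

Lemma represents_id s W :
  brackets s W -> represents (idm (ev s)) (idm W : @hom (barCat C) W W).
Proof.
move=> hs; have h := brackets_same hs (brackets_brk (brk0 W)).
by exists h, (same_word_sym h); rewrite rep_id coh_id compm1 Ucoh_K.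
Qed.

Lemma represents_comp r s t W V Z (g : hom (ev s) (ev t)) (f : hom (ev r) (ev s))
    (psi : @hom (barCat C) V Z) (phi : @hom (barCat C) W V) :
  represents g psi -> represents f phi -> represents (g \c f) (psi \c phi).
Proof.
case=> [hs [ht ->]] [hr [hs' ->]]; exists hr, ht.
rewrite (rep_comp _ (brk0 V)) comp_cancel //.
exact: Ucoh_K.
Qed.

Lemma represents_cls_pair W W' V V' (a : brk W) (a' : brk W') (b : brk V)
    (b' : brk V') (f : hom (ev a \ox ev a') (ev b \ox ev b')) :
  @represents (Node a a') (Node b b') _ _ f (cls_pair f).
Proof.
have w (U : barobj C) (c : brk U) : is_word (leaves c) by rewrite brkP wordP.
have ep (U U' : barobj C) (c : brk U) (c' : brk U') :
    prune (Node c c') = prune (brk_pair c c').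
  rewrite (prune_word (w _ (brk_pair c c'))) /=.
  by rewrite (prune_word (w _ c)) (prune_word (w _ c')).
have sw (U U' : barobj C) (c : brk U) (c' : brk U') :
    same_word (Node c c') (brk_pair c c').
  by rewrite /same_word -!leaves_prune ep.
have := represents_move (sw _ _ a a') (same_word_sym (sw _ _ b b'))
  (@represents_cls _ _ (brk_pair a a') (brk_pair b b')
    (coe (esym (ev_pair b b')) \c f \c coe (ev_pair a a'))).
rewrite (Ucoh_coe (sw _ _ a a') (ep _ _ _ _) (esym (ev_pair a a'))).
rewrite (Ucoh_coe _ (esym (ep _ _ _ _)) (ev_pair b b')).
by rewrite comp_conj coeVK coe_coe coe_id comp1m compm1.
Qed.

Lemma represents_tens s t s' t' W V W' V' (f : hom (ev s) (ev t))
    (f' : hom (ev s') (ev t')) (phi : @hom (barCat C) W V)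
    (phi' : @hom (barCat C) W' V') :
  represents f phi -> represents f' phi' ->
  @represents (Node s s') (Node t t') _ _ (f \om f') (phi \bm phi').
Proof.
case=> [hs [ht ->]] [hs' [ht' ->]].
rewrite tensm_comp3.
rewrite -(Ucoh_tens ht ht' (same_word_node ht ht')).
rewrite -(Ucoh_tens hs hs' (same_word_node hs hs')).
exact: (represents_move (same_word_node hs hs') (same_word_node ht ht')
  (represents_cls_pair
    (rep (brk0 W) (brk0 V) phi \om rep (brk0 W') (brk0 V') phi'))).
Qed.

Lemma represents_Psi s t W V : brackets s W -> brackets t V ->
  @represents (Node s t) (Node t s) _ _ (Psi (ev s) (ev t)) (PsiB W V).
Proof.
move=> hs ht.
have es := brackets_same hs (brackets_brk (brk0 W)).
have et := brackets_same ht (brackets_brk (brk0 V)).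
have := represents_move (same_word_node es et)
  (same_word_node (same_word_sym et) (same_word_sym es))
  (represents_cls_pair (Psi (ev (brk0 W)) (ev (brk0 V)))).
rewrite (Ucoh_tens es et) (Ucoh_tens (same_word_sym et) (same_word_sym es)) -compA.
rewrite [_ \c (Ucoh es \om Ucoh et)]Psi_nat compA -tensm_comp.
by rewrite !Ucoh_K tensm_id comp1m.
Qed.

Lemma represents_add s t W V (f g : hom (ev s) (ev t))
    (phi psi : @hom (barCat C) W V) :
  represents f phi -> represents g psi -> represents (f + g) (phi + psi).
Proof.
case=> hs [ht ->] [hs' [ht' ->]]; exists hs, ht.
by rewrite (Ucoh_irr hs' hs) (Ucoh_irr ht' ht) repD compDr compDl.
Qed.

End Represents.

Section RibbonRepresents.
Variables (C : braidedCat) (A : ribbonData C).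

Lemma represents_mul :
  @represents C (Node (Leaf (car A)) (Leaf (car A))) (Leaf (car A)) _ _
    (mul A) (mulB A).
Proof.
set X := car A; pose a := brk_letter X.
have ep : prune (Node (Leaf X) (Leaf X)) = prune (brk_pair a a).
  by rewrite [RHS]prune_word // brkP wordP.
have sw : same_word (Node (Leaf X) (Leaf X)) (brk_pair a a).
  by rewrite /same_word -!leaves_prune ep.
have := represents_move sw (erefl : same_word a (Leaf X))
  (@represents_cls _ _ _ (brk_pair a a) a (mul A \c coe (ev_pair a a))).
rewrite Ucoh_id comp1m (Ucoh_coe _ ep (esym (ev_pair a a))) -compA.
by rewrite (coe_coe (esym (ev_pair a a))) coe_id compm1.
Qed.

Lemma represents_eta :
  @represents C (Leaf one) (Leaf (car A)) _ _ (eta A) (etaB A).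
Proof. exact: (represents_cls (a := brk_one C) (b := brk_letter (car A))). Qed.

Lemma represents_rib :
  @represents C (Leaf (car A)) (Leaf (car A)) _ _ (rib A) (ribB A).
Proof.
exact: (represents_cls (a := brk_letter (car A)) (b := brk_letter (car A))).
Qed.

End RibbonRepresents.

(** * The functor between the strict extensions *)

Lemma fmor_coe (C D : abCat) (F : abFunctor C D) (U V : C) (e : U = V)
    (e' : F U = F V) : fmor F (coe e) = coe e'.
Proof. by case: V / e e' => e'; rewrite fmor_id coe_id. Qed.

Section BarFunctorTheory.
Variables (C D : braidedCat) (T : tensorFunctor C D).
Implicit Types (s t : tree C) (W V Z : barobj C).

Lemma same_word_map s t :
  same_word s t -> same_word (tree_map T s) (tree_map T t).
Proof.
rewrite /same_word !leaves_map => e.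
have : barT_obj T (wordB (leaves s)) = barT_obj T (wordB (leaves t)).
  by congr barT_obj; apply: eq_barobj.
by rewrite !barT_wordB => /(congr1 (@word D)).
Qed.

Lemma brackets_map t W : brackets t W -> brackets (tree_map T t) (barT_obj T W).
Proof.
rewrite /brackets leaves_map => e.
have -> : W = wordB (leaves t) by apply: eq_barobj.
by rewrite barT_wordB.
Qed.

Lemma barT_tensB W V :
  barT_obj T (W \bx V) = barT_obj T W \bx barT_obj T V.
Proof. by rewrite {1}/tensB barT_wordB /barT_obj wordB_cat map_cat. Qed.

(** By induction on a chain of moves from [s] to [t]: naturality of [tF] for
    congruence, [tF_Phi] for associativity, [tF1U] and [tFU1] for the units. *)
Lemma S_Ucoh s t (e : same_word s t)
    (e' : same_word (tree_map T s) (tree_map T t)) :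
  S_iso T t \c Ucoh e' = fmor T (Ucoh e) \c S_iso T s.
Proof.
have := same_word_coheq e; move=> h; elim: h e e' => {s t}.
- by move=> t e e'; rewrite !Ucoh_id fmor_id comp1m compm1.
- move=> s t h IH e e'.
  have e1 := coheq_word h; have e1' := same_word_map e1.
  (* Conjugates the hypothesis for the reversed move by the coherences [e]. *)
  have := congr1 (fun x => fmor T (Ucoh e) \c x \c Ucoh e') (IH e1 e1').
  rewrite /= !compA -fmor_comp Ucoh_K fmor_id comp1m.
  by rewrite -(compA _ (Ucoh e1')) Ucoh_K compm1 => <-.
- move=> r s t h IH h2 IH2 e e'.
  have e1 := coheq_word h; have e1' := same_word_map e1.
  have e2 := coheq_word h2; have e2' := same_word_map e2.
  rewrite -(Ucoh_comp e1' e2' e') -(Ucoh_comp e1 e2 e) fmor_comp compA IH2.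
  by rewrite -!compA IH.
- move=> a a' b b' ha IHa hb IHb e e'.
  have ea := coheq_word ha; have ea' := same_word_map ea.
  have eb := coheq_word hb; have eb' := same_word_map eb.
  rewrite (Ucoh_tens ea eb e) (Ucoh_tens ea' eb' e') /= -compA -tensm_comp IHa IHb.
  by rewrite tensm_comp !compA tF_nat.
- move=> a b c e e'; rewrite !Ucoh_Phi.
  (* By hand, since simplification would also unfold [tree_map]. *)
  pose F := tF T; rewrite -[S_iso T (Node a (Node b c)) : hom _ _]/(
    F (ev a) (ev b \ox ev c)
      \c (S_iso T a \om (F (ev b) (ev c) \c (S_iso T b \om S_iso T c)))).
  rewrite -[S_iso T (Node (Node a b) c) : hom _ _]/(
    F (ev a \ox ev b) (ev c)
      \c ((F (ev a) (ev b) \c (S_iso T a \om S_iso T b)) \om S_iso T c)).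
  rewrite tensm_split_r tensm_split_l !compA tF_Phi -!compA.
  by rewrite [X in _ = _ \c (_ \c X)]Phi_nat.
- move=> t e e'; have [q q'] : prune (Node (Leaf one) t) = prune t /\
      prune (Node (Leaf (T one)) (tree_map T t)) = prune (tree_map T t).
    by rewrite /= /pair_tree /= !tfun1 !nonunit1.
  have f : T one \ox T (ev t) = T (ev t) by rewrite tfun1 tens1U.
  have f' : T one \ox ev (tree_map T t) = ev (tree_map T t).
    by rewrite tfun1 tens1U.
  rewrite (Ucoh_coe e q (tens1U _)) (Ucoh_coe e' q' f').
  rewrite (fmor_coe _ (congr1 T (tens1U (ev t)))) /=.
  rewrite (tF1U (etrans f (esym (congr1 T (tens1U (ev t)))))).
  rewrite compA coe_coe (coe_irr _ f) -[idm _]/(coe (erefl (T one))).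
  by rewrite (tens1_coe _ (tfun1 T) (tfun1 T) _ f').
- move=> t e e'; have [q q'] : prune (Node t (Leaf one)) = prune t /\
      prune (Node (tree_map T t) (Leaf (T one))) = prune (tree_map T t).
    rewrite /= /pair_tree /= !tfun1 !nonunit1 /=.
    by split; case: ifP => // /unit_leafP.
  have f : T (ev t) \ox T one = T (ev t) by rewrite tfun1 tensU1.
  have f' : ev (tree_map T t) \ox T one = ev (tree_map T t).
    by rewrite tfun1 tensU1.
  rewrite (Ucoh_coe e q (tensU1 _)) (Ucoh_coe e' q' f').
  rewrite (fmor_coe _ (congr1 T (tensU1 (ev t)))) /=.
  rewrite (tFU1 (etrans f (esym (congr1 T (tensU1 (ev t)))))).
  rewrite compA coe_coe (coe_irr _ f) -[idm _]/(coe (erefl (T one))).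
  by rewrite (tens_coe1 _ (tfun1 T) (tfun1 T) _ f').
Qed.

Definition conjS s t (f : hom (ev s) (ev t)) :
    hom (ev (tree_map T s)) (ev (tree_map T t)) :=
  iso_inv (S_iso T t) \c fmor T f \c S_iso T s.

Lemma conjS_comp r s t (g : hom (ev s) (ev t)) (f : hom (ev r) (ev s)) :
  conjS g \c conjS f = conjS (g \c f).
Proof. by rewrite /conjS comp_cancel ?isoVK // fmor_comp. Qed.

Lemma conjS_Ucoh s t (e : same_word s t)
  (e' : same_word (tree_map T s) (tree_map T t)) : conjS (Ucoh e) = Ucoh e'.
Proof. by rewrite /conjS -compA -(S_Ucoh e e') compA isoK comp1m. Qed.

Lemma conjS_tens s s' t t' (f : hom (ev s) (ev t)) (f' : hom (ev s') (ev t')) :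
  @conjS (Node s s') (Node t t') (f \om f') = conjS f \om conjS f'.
Proof.
rewrite /conjS tensm_comp3 /= -!compA; congr (_ \c _).
by rewrite (compA (fmor T _)) -tF_nat -compA (compA (iso_inv _)) isoK comp1m.
Qed.

Lemma conjS_Psi s t :
  @conjS (Node s t) (Node t s) (Psi (ev s) (ev t)) =
  Psi (ev (tree_map T s)) (ev (tree_map T t)).
Proof.
rewrite /conjS /= -compA (compA (fmor T _)) tF_Psi -!compA.
rewrite (compA (iso_inv (tF T _ _))) isoK comp1m Psi_nat compA -tensm_comp.
by rewrite !isoK tensm_id comp1m.
Qed.

(** The definition of [barT] is the case of one chosen pair of bracketings;
    [conjS_Ucoh] carries it to all others, so the class does not depend on the
    choice. *)
Lemma represents_barT s t W V (f : hom (ev s) (ev t))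
    (phi : @hom (barCat C) W V) :
  represents f phi -> represents (conjS f) (barT T phi).
Proof.
case=> hs [ht ->]; pose a := brk0 W; pose b := brk0 V.
(* [T] may create unit letters, which [barT] erases: compare both trees. *)
have key (c : tree C) : prune (tree_map T c) = prune (prune (tree_map T c)).
  by rewrite (prune_word (prune_is_word _)).
have pr (c : tree C) : same_word (tree_map T c) (prune (tree_map T c)).
  by rewrite /same_word -!leaves_prune -key.
have ra : represents (conjS (rep a b phi)) (barT T phi).
  have := represents_move (pr a) (same_word_sym (pr b))
    (represents_cls (a := brk_map T a) (b := brk_map T b)
    (coe (esym (ev_prune (tree_map T b))) \c iso_inv (S_iso T b)
       \c fmor T (rep a b phi) \c S_iso T a \c coe (ev_prune (tree_map T a)))).
  rewrite (Ucoh_coe (pr a) (key a) (esym (ev_prune _))).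
  rewrite (Ucoh_coe _ (esym (key b)) (ev_prune _)) !compA coeVK comp1m -compA.
  by rewrite coe_coe coe_id compm1.
have hs' := same_word_map hs; have ht' := same_word_map ht.
rewrite -conjS_comp -(conjS_comp (Ucoh ht)) (conjS_Ucoh ht ht') (conjS_Ucoh hs hs').
exact: (represents_move hs' ht' ra).
Qed.

(** The images of tensor words and of powers are only provably equal to the words
    they are compared with; the relation hides the two casts and, unlike an
    equation with casts, is stable under all operations. *)
Definition barT_img W V (W' V' : barobj D) (phi : @hom (barCat C) W V)
    (phi' : @hom (barCat D) W' V') : Prop :=
  exists (eW : barT_obj T W = W') (eV : barT_obj T V = V'),
    phi' = coe eV \c barT T phi \c coe (esym eW).

(** Turns statements about images into computations with representatives. *)
Lemma barT_imgP s t W V (W' V' : barobj D) (f : hom (ev s) (ev t))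
    (phi : @hom (barCat C) W V) (phi' : @hom (barCat D) W' V') :
  barT_obj T W = W' -> barT_obj T V = V' ->
  represents f phi -> represents (conjS f) phi' <-> barT_img phi phi'.
Proof.
move=> eW eV; case: W' / eW phi'; case: V' / eV => phi' hf.
have hf' := represents_barT hf; split=> [h|[eW [eV ->]]]; last first.
  by rewrite !coe_id comp1m compm1.
exists erefl, erefl; rewrite !coe_id comp1m compm1.
exact: represents_inj h hf'.
Qed.

Arguments barT_imgP {s t W V W' V' f phi phi'} _ _ _.

(** Equations between images are proved by relating both sides to one morphism. *)
Lemma barT_img_fun W V (W' V' : barobj D) (phi : @hom (barCat C) W V)
    (phi' psi' : @hom (barCat D) W' V') :
  barT_img phi phi' -> barT_img phi psi' -> phi' = psi'.
Proof.
case=> eW [eV ->] [eW' [eV' ->]].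
by rewrite (coe_irr eV eV') (coe_irr (esym eW) (esym eW')).
Qed.

Lemma represents_brk0 W V (phi : @hom (barCat C) W V) :
  represents (rep (brk0 W) (brk0 V) phi) phi.
Proof. exact: represents_rep. Qed.

Lemma barT_img_comp W V Z (W' V' Z' : barobj D) (psi : @hom (barCat C) V Z)
    (phi : @hom (barCat C) W V) (psi' : @hom (barCat D) V' Z')
    (phi' : @hom (barCat D) W' V') :
  barT_img psi psi' -> barT_img phi phi' ->
  barT_img (psi \c phi) (psi' \c phi').
Proof.
move=> hpsi hphi; have [eV [eZ _]] := hpsi; have [eW _] := hphi.
have rg := represents_brk0 psi; have rf := represents_brk0 phi.
apply/(barT_imgP eW eZ (represents_comp rg rf)); rewrite -conjS_comp.
by apply: represents_comp;
  [apply/(barT_imgP eV eZ rg) | apply/(barT_imgP eW eV rf)].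
Qed.

Lemma barT_img_tens W V Z Y (W' V' Z' Y' : barobj D)
    (phi : @hom (barCat C) W V) (psi : @hom (barCat C) Z Y)
    (phi' : @hom (barCat D) W' V') (psi' : @hom (barCat D) Z' Y') :
  barT_img phi phi' -> barT_img psi psi' ->
  barT_img (phi \bm psi) (phi' \bm psi').
Proof.
move=> hphi hpsi; have [eW [eV _]] := hphi; have [eZ [eY _]] := hpsi.
have rf := represents_brk0 phi; have rg := represents_brk0 psi.
apply/(barT_imgP _ _ (represents_tens rf rg)).
- by rewrite barT_tensB eW eZ.
- by rewrite barT_tensB eV eY.
rewrite conjS_tens.
by apply: represents_tens;
  [apply/(barT_imgP eW eV rf) | apply/(barT_imgP eZ eY rg)].
Qed.

Lemma barT_img_coe W V (W' V' : barobj D) (e : W = V) (e' : W' = V') :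
  barT_obj T W = W' ->
  barT_img (coe e : @hom (barCat C) W V) (coe e' : @hom (barCat D) W' V').
Proof.
move=> eW; case: V / e; case: V' / e'; case: W' / eW.
have hr := represents_id (brackets_brk (brk0 W)).
apply/(barT_imgP _ _ hr) => //.
rewrite /conjS fmor_id compm1 isoK.
exact: represents_id (brackets_map (brackets_brk (brk0 W))).
Qed.

Lemma barT_img_id W (W' : barobj D) : barT_obj T W = W' ->
  barT_img (idm W : @hom (barCat C) W W) (idm W' : @hom (barCat D) W' W').
Proof. by move=> eW; apply: (barT_img_coe erefl erefl). Qed.

Lemma barT_img_Psi W V (W' V' : barobj D) : barT_obj T W = W' ->
  barT_obj T V = V' -> barT_img (PsiB W V) (PsiB W' V').
Proof.
move=> eW eV; have bW := brackets_brk (brk0 W); have bV := brackets_brk (brk0 V).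
apply/(barT_imgP _ _ (represents_Psi bW bV)); try by rewrite barT_tensB eW eV.
rewrite conjS_Psi -eW -eV.
by apply: represents_Psi; apply: brackets_map.
Qed.

Lemma barT_img_pow W (W' : barobj D) (phi : @hom (barCat C) W W)
    (phi' : @hom (barCat D) W' W') n :
  barT_img phi phi' -> barT_img (pow_end phi n) (pow_end phi' n).
Proof.
move=> h; elim: n => [|n IH] /=; last exact: barT_img_comp.
by case: h => eW _; apply: barT_img_id.
Qed.

Lemma barT_zmod W V : zmod_morphism (@barT C D T W V).
Proof.
have hD : {morph @barT C D T W V : f g / f + g >-> f + g}.
  move=> f g.
  have rf := represents_brk0 f; have rg := represents_brk0 g.
  apply: represents_inj (represents_barT (represents_add rf rg)) _.
  rewrite /conjS fmorD compDr compDl.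
  by apply: represents_add; apply: represents_barT.
by move=> f g; apply: (canRL (addrK _)); rewrite -hD subrK.
Qed.

Lemma barT_img_opp W V (W' V' : barobj D) (phi : @hom (barCat C) W V)
    (phi' : @hom (barCat D) W' V') :
  barT_img phi phi' -> barT_img (- phi) (- phi').
Proof.
case=> eW [eV ->]; exists eW, eV.
have bT0 := barT_zmod phi phi; rewrite !subrr in bT0.
by rewrite -[in RHS](sub0r phi) barT_zmod bT0 sub0r compmN compNm.
Qed.

Lemma barT_img_sign W V (W' V' : barobj D) (phi : @hom (barCat C) W V)
    (phi' : @hom (barCat D) W' V') n :
  barT_img phi phi' -> barT_img (phi *~ (-1) ^+ n) (phi' *~ (-1) ^+ n).
Proof.
move=> h; rewrite -signr_odd; case: (odd n); rewrite ?expr1 ?expr0.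
  by rewrite !mulrN1z; apply: barT_img_opp.
by rewrite !mulr1z.
Qed.

(** * Images of the structure morphisms of a ribbon algebra *)

Section RibbonImage.
Variable A : ribbonData C.
Let A' := ribbon_image T A.

Lemma barT_img_mul : barT_img (mulB A) (mulB A').
Proof.
apply/(barT_imgP (barT_letter2 T _) (barT_letter T _) (represents_mul A)).
have := represents_mul A'; congr represents.
by rewrite /conjS /= tensm_id compm1 comp1m.
Qed.

(** The source of the unit of the image is the unit object, while that of the
    functor image is [T one]: the cast in [ribbon_image] is the coherence
    isomorphism between the two. *)
Lemma barT_img_eta : barT_img (etaB A) (etaB A').
Proof.
apply/(barT_imgP (barT_one T) (barT_letter T _) (represents_eta A)).
have sw : same_word (Leaf (T one)) (Leaf (one : D)).
  by rewrite /same_word /= tfun1.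
have := represents_move sw (erefl : same_word (Leaf (car A')) _) (represents_eta A').
rewrite Ucoh_id (Ucoh_coe sw (congr1 (@Leaf D) (tfun1 T)) (tfun1 T)).
congr represents.
by rewrite /conjS /= !comp1m compm1 -compA coe_coe coe_id compm1.
Qed.

Lemma barT_img_rib : barT_img (ribB A) (ribB A').
Proof.
apply/(barT_imgP (barT_letter T _) (barT_letter T _) (represents_rib A)).
have := represents_rib A'; congr represents.
by rewrite /conjS /= compm1 comp1m.
Qed.

Let P n := powB (car A) n.

Lemma barT_img_twist n : barT_img (twist A n) (twist A' n).
Proof.
apply: barT_img_comp.
  by apply: barT_img_tens barT_img_rib _; apply/barT_img_id/barT_powB.
by apply: barT_img_Psi; [apply: barT_powB | apply: barT_letter].
Qed.

Lemma barT_img_cyc n : barT_img (cyc_mor A n) (cyc_mor A' n).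
Proof.
apply: barT_img_sign; apply: barT_img_comp; last first.
  by apply: barT_img_coe; apply: barT_powB.
apply: barT_img_comp (barT_img_twist n).
by apply: barT_img_coe; rewrite barT_tensB barT_letter barT_powB.
Qed.

Lemma barT_img_face n (i : 'I_n.+2) : barT_img (face_mor A i) (face_mor A' i).
Proof.
rewrite /face_mor; case: unlift => [j|].
  apply: barT_img_comp; last by apply: barT_img_coe; apply: barT_powB.
  apply: barT_img_comp.
    by apply: barT_img_coe; rewrite !barT_tensB barT_letter !barT_powB.
  by do 2?apply: barT_img_tens; try exact: barT_img_mul;
    apply/barT_img_id/barT_powB.
apply: barT_img_comp; last by apply: barT_img_coe; apply: barT_powB.
apply: barT_img_comp (barT_img_twist _).
apply: barT_img_comp; last first.
  by apply: barT_img_coe; rewrite !barT_tensB barT_letter !barT_powB.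
apply: barT_img_comp; last first.
  by apply: barT_img_tens barT_img_mul _; apply/barT_img_id/barT_powB.
by apply: barT_img_coe; rewrite barT_tensB barT_letter barT_powB.
Qed.

Lemma barT_img_degen n (i : 'I_n.+1) :
  barT_img (degen_mor A i) (degen_mor A' i).
Proof.
apply: barT_img_comp; last by apply: barT_img_coe; apply: barT_powB.
apply: barT_img_comp.
  by apply: barT_img_coe; rewrite !barT_tensB barT_letter !barT_powB.
apply: barT_img_tens; last by apply/barT_img_id/barT_powB.
by apply: barT_img_tens barT_img_eta; apply/barT_img_id/barT_powB.
Qed.

Lemma barT_img_cochain n (phi : ambient (ribbon_cocyclic A) n) :
  barT_img (phi : @hom (barCat C) _ _)
    (barT_cochain T phi : @hom (barCat D) _ _).
Proof. by exists (barT_powB T (car A) n.+1), (barT_one T). Qed.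

(** The cocyclic structure acts by precomposition, so this reduces its
    preservation to the images of the structure morphisms. *)
Lemma barT_cochain_comp m n (phi : ambient (ribbon_cocyclic A) n)
    (f : hom (P m.+1) (P n.+1))
    (f' : hom (powB (T (car A)) m.+1) (powB (T (car A)) n.+1)) :
  barT_img f f' ->
  barT_cochain T (phi \c f : ambient (ribbon_cocyclic A) m) =
  barT_cochain T phi \c f' :> @hom (barCat D) _ _.
Proof.
move=> h; apply: barT_img_fun (barT_img_cochain _) _.
exact: barT_img_comp (barT_img_cochain _) h.
Qed.

End RibbonImage.

End BarFunctorTheory.

(** Associativity lives in the strict extension and is transported by [barT_img];
    the unit and ribbon axioms live in the category itself and follow from
    naturality of [tF] and its compatibility with units and braidings. *)
Lemma ribbon_image_ribbon (C D : braidedCat) (T : tensorFunctor C D)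
    (A : ribbonData C) :
  is_ribbon_algebra A -> is_ribbon_algebra (ribbon_image T A).
Proof.
case=> -[assoc unitr unitl] [k [kK Kk]] twistm twist1.
split; [split | | | ].
- have iid := barT_img_id (barT_letter T (car A)); have im := barT_img_mul T A.
  apply: barT_img_fun (barT_img_comp im (barT_img_tens im iid)).
  rewrite -assoc; apply: barT_img_comp.
    exact: barT_img_comp im (barT_img_tens iid im).
  by apply: barT_img_coe; rewrite !barT_tensB barT_letter.
- rewrite /= -[idm _]/(idm (T (car A))) tensm_split_r -(fmor_id T).
  rewrite compA -(compA (fmor T _)) tF_nat compA -fmor_comp unitr.
  have e := congr1 T (tensU1 (car A)).
  have e1 : T (car A) \ox T one = T (car A \ox one) by rewrite e tfun1 tensU1.
  have e2 : T (car A) \ox one = T (car A) \ox T one by rewrite tfun1.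
  rewrite fmor_id (fmor_coe _ e) (tFU1 e1) -[idm _]/(coe erefl) (tens_coe _ _ e2).
  by rewrite !coe_coe; apply: coe_irr.
- rewrite /= -[idm _]/(idm (T (car A))) tensm_split_l -(fmor_id T).
  rewrite compA -(compA (fmor T _)) tF_nat compA -fmor_comp unitl.
  have e := congr1 T (tens1U (car A)).
  have e1 : T one \ox T (car A) = T (one \ox car A) by rewrite e tfun1 tens1U.
  have e2 : one \ox T (car A) = T one \ox T (car A) by rewrite tfun1.
  rewrite fmor_id (fmor_coe _ e) (tF1U e1) -[idm _]/(coe erefl) (tens_coe _ _ e2).
  by rewrite !coe_coe; apply: coe_irr.
- by exists (fmor T k); rewrite /= -!fmor_comp kK Kk !fmor_id.
- rewrite /= -(compA (fmor T _)) tF_nat -!compA (compA (iso_hom (tF T _ _))) -tF_Psi.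
  rewrite -(compA (fmor T _) (iso_hom _)) -tF_Psi !compA -!fmor_comp.
  by rewrite twistm.
- by rewrite /= compA -fmor_comp twist1.
Qed.

(** * Bijectivity for invertible functors *)

Lemma fid_bij (C : abCat) (H : abFunctor C C) (U V : C) :
  H = fid C -> bijective (@fmor C C H U V).
Proof. by move->; exists id. Qed.

(** A left inverse of [G \o F] on morphisms, after [G], is a left inverse of [F];
    it is also a right inverse since [G] is injective on morphisms, [F \o G] being
    so. *)
Lemma invertible_bij (C D : abCat) (F : abFunctor C D) (U V : C) :
  invertible F -> bijective (@fmor C D F U V).
Proof.
case=> G [GF FG].
have injG (X Y : D) : injective (@fmor D C G X Y).
  have [k kK _] := fid_bij X Y FG => f g e; apply: (can_inj kK) => /=.
  by rewrite e.
have [k kK Kk] := fid_bij U V GF.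
exists (fun h => k (fmor G h)) => [f|h]; first exact: kK.
by apply: injG; apply: Kk.
Qed.

Section FullyFaithful.
Variables (C D : braidedCat) (T : tensorFunctor C D).
Hypothesis ffT : forall U V : C, bijective (@fmor C D T U V).

Lemma conjS_bij s t : bijective (@conjS C D T s t).
Proof.
have [k kK Kk] := ffT (ev s) (ev t).
exists (fun h => k (S_iso T t \c h \c iso_inv (S_iso T s))) => [f|h].
  rewrite /conjS -!compA isoVK compm1 compA isoVK comp1m; exact: kK.
by rewrite /conjS Kk -!compA isoK compm1 compA isoK comp1m.
Qed.

(** On representatives, the functor is conjugation by [S_iso]. *)
Lemma barT_bij W V : bijective (@barT C D T W V).
Proof.
have [k kK Kk] := conjS_bij (brk0 W) (brk0 V).
have bW := brackets_brk (brk0 W); have bV := brackets_brk (brk0 V).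
suff [inj surj] : injective (@barT C D T W V) /\
    (forall psi, exists phi, @barT C D T W V phi = psi).
  exists (fun psi => sval (cid (surj psi))) => [phi|psi]; last by case: cid.
  by apply: inj; case: cid.
split=> [phi psi e|psi].
  have rf := represents_brk0 phi; have rg := represents_brk0 psi.
  have := represents_barT T rf; rewrite e => /represents_fun.
  move=> /(_ _ (represents_barT T rg)) /(can_inj kK) eq_rep.
  by rewrite eq_rep in rf; apply: represents_inj rf rg.
have [h hr] := represents_ex psi (brackets_map T bW) (brackets_map T bV).
exists (cls (k h)).
by apply: represents_inj (represents_barT T (represents_cls _)) _; rewrite Kk.
Qed.

Lemma barT_cochain_bij (A : ribbonData C) n :
  bijective (@barT_cochain C D T A n).
Proof.
have [k kK Kk] := barT_bij (powB (car A) n.+1) (oneB C).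
exists (fun psi : ambient (ribbon_cocyclic (ribbon_image T A)) n =>
  k (coe (esym (barT_one T)) \c psi \c coe (barT_powB T (car A) n.+1))).
- move=> phi; rewrite /barT_cochain comp_conj !coeK comp1m compm1.
  exact: kK.
- move=> psi; rewrite /barT_cochain Kk comp_conj !coeVK comp1m.
  by rewrite compm1.
Qed.

End FullyFaithful.

(** * The map of cocyclic modules *)

Section CochainMap.
Variables (C D : braidedCat) (T : tensorFunctor C D) (A : ribbonData C).
Let M := ribbon_cocyclic A.
Let N := ribbon_cocyclic (ribbon_image T A).
Let f n : ambient M n -> ambient N n := @barT_cochain C D T A n.

Lemma barT_cochain_zmod n : zmod_morphism (@f n).
Proof.
by move=> x y; rewrite /f /barT_cochain barT_zmod compDr compmN compBl.
Qed.

Lemma barT_cochain_face n (i : 'I_n.+2) x :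
  f (face M i x) = face N i (f x).
Proof. exact: barT_cochain_comp (barT_img_face T A i). Qed.

Lemma barT_cochain_degen n (i : 'I_n.+1) (x : ambient M n.+1) :
  f (degen M i x) = degen N i (f x).
Proof. exact: barT_cochain_comp (barT_img_degen T A i). Qed.

Lemma barT_cochain_cyc n (x : ambient M n) : f (cyc M n x) = cyc N n (f x).
Proof. exact: barT_cochain_comp (barT_img_cyc T A n). Qed.

Lemma barT_cochain_pow n (x : ambient M n) :
  f (x \c pow_end (cyc_mor A n) n.+1 : ambient M n) =
  f x \c pow_end (cyc_mor (ribbon_image T A) n) n.+1.
Proof. exact: barT_cochain_comp (barT_img_pow n.+1 (barT_img_cyc T A n)). Qed.

Lemma barT_cochain_morphism : @cocyclic_morphism M N f.
Proof.
split=> [n x|n x y _ _|n i x _|n i x _|n x _].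
- rewrite !unfold_in /= => /eqP e; apply/eqP.
  by rewrite -[RHS](congr1 (@f n) e) barT_cochain_pow.
- have fD := barT_cochain_zmod.
  by apply/(canRL (subrK _)); rewrite -fD addrK.
- exact: barT_cochain_face.
- exact: barT_cochain_degen.
- exact: barT_cochain_cyc.
Qed.

Hypothesis f_inj : forall n, injective (@f n).

Lemma barT_cochain_in n (x : ambient M n) :
  (f x \in cochain N n) = (x \in cochain M n).
Proof.
apply/idP/idP; last exact: (cm_cochain barT_cochain_morphism).
rewrite !unfold_in /= => /eqP e; apply/eqP/f_inj.
by rewrite [LHS]barT_cochain_pow.
Qed.

Lemma barT_cyclic_in n (x : ambient M n) :
  (f x \in cyclic_cochain N n) = (x \in cyclic_cochain M n).
Proof.
rewrite ![_ \in cyclic_cochain _ _]/(_ && _) barT_cochain_in.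
by rewrite -barT_cochain_cyc (inj_eq (@f_inj n)).
Qed.

End CochainMap.

Lemma cocyclic_morphism_inv (M N : cocyclicData)
    (f : forall n, ambient M n -> ambient N n)
    (g : forall n, ambient N n -> ambient M n) :
  cocyclic_morphism f ->
  (forall n, cancel (f n) (g n)) -> (forall n, cancel (g n) (f n)) ->
  (forall n x, (f n x \in cochain N n) = (x \in cochain M n)) ->
  cocyclic_isomorphism f.
Proof.
move=> hf fK gK f_in; split=> //; exists g.
have g_in n y : y \in cochain N n -> g n y \in cochain M n.
  by move=> hy; rewrite -f_in gK.
split; [|by move=> n x _; apply: fK|by move=> n x _; apply: gK].
split=> [//|n x y hx hy|n i x hx|n i x hx|n x hx]; apply: (can_inj (fK _));
  rewrite gK.
- by rewrite (cm_add hf) ?g_in // !gK.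
- by rewrite (cm_face hf) ?g_in // gK.
- by rewrite (cm_degen hf) ?g_in // gK.
- by rewrite (cm_cyc hf) ?g_in // gK.
Qed.

(** * Isomorphisms induced in cohomology *)

Lemma cohomology_class_eq (M : cocyclicData)
    (S : forall n, zmodClosed (ambient M n)) n (x y : cocycles S n) :
  (cohomology_class x == cohomology_class y) = (x - y \in coboundaries S n).
Proof. by rewrite /cohomology_class -Quotient.idealrBE. Qed.

Lemma cohomology_classB (M : cocyclicData)
    (S : forall n, zmodClosed (ambient M n)) n (x y : cocycles S n) :
  cohomology_class (x - y) = cohomology_class x - cohomology_class y.
Proof. by rewrite /cohomology_class raddfB. Qed.

Section InducedMap.
Variables (M N : cocyclicData).
Variable f : forall n, {additive ambient M n -> ambient N n}.
Variables (S : forall n, zmodClosed (ambient M n))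
          (S' : forall n, zmodClosed (ambient N n)).
Hypothesis f_in : forall n x, (f n x \in S' n) = (x \in S n).
Hypothesis f_face : forall n (i : 'I_n.+2) x,
  f n.+1 (face M i x) = face N i (f n x).
Hypothesis f_bij : forall n, bijective (f n).

Lemma diff_comm n x : f n.+1 (diff x) = diff (f n x).
Proof.
by rewrite raddf_sum; apply: eq_bigr => i _; rewrite raddfMz f_face.
Qed.

(** Injectivity is what lets the image detect that the differential of x is 0. *)
Lemma cocycle_image n (x : ambient M n) :
  (f n x \in @cocycle _ S' n) = (x \in @cocycle _ S n).
Proof.
rewrite ![_ \in @cocycle _ _ _]/(_ && _) f_in -diff_comm -(raddf0 (f n.+1)).
by rewrite (bij_eq (f_bij n.+1)).
Qed.

Lemma cocycle_map_subproof n (z : cocycles S n) :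
  f n (cocycle_val z) \in @cocycle _ S' n.
Proof. by rewrite cocycle_image; apply: valP. Qed.

Definition cocycle_map n (z : cocycles S n) : cocycles S' n :=
  Cocycle (cocycle_map_subproof z).

Lemma cocycle_map_zmod n : zmod_morphism (@cocycle_map n).
Proof. by move=> x y; apply: val_inj; rewrite /= raddfB. Qed.

(** Surjectivity provides a primitive upstairs, injectivity shows that it has
    the right differential. *)
Lemma coboundary_image n (z : cocycles S n) :
  (cocycle_map z \in coboundaries S' n) = (z \in coboundaries S n).
Proof.
case: n z => [|n] z; rewrite !unfold_in /=.
  (* In degree 0 the only coboundary is 0. *)
  by rewrite -!(inj_eq val_inj) /= -(raddf0 (f 0)) (bij_eq (f_bij 0)).
have [k kK Kk] := f_bij n.
apply/asboolP/asboolP => -[y hy e]; last first.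
  by exists (f n y); rewrite ?f_in // e diff_comm.
exists (k y); first by rewrite -f_in Kk.
by apply: (bij_inj (f_bij n.+1)); rewrite diff_comm Kk.
Qed.

Definition cohomology_map n (q : cohomology S n) : cohomology S' n :=
  cohomology_class (cocycle_map (repr q)).

Lemma cohomology_mapE n (z : cocycles S n) :
  cohomology_map (cohomology_class z) = cohomology_class (cocycle_map z).
Proof.
apply/eqP; rewrite cohomology_class_eq -cocycle_map_zmod coboundary_image.
by rewrite -cohomology_class_eq /cohomology_class reprK.
Qed.

Lemma cohomology_map_zmod n : zmod_morphism (@cohomology_map n).
Proof.
move=> p q; rewrite -(reprK p) -(reprK q).
rewrite -![\pi_(_) (repr _)]/(cohomology_class _) -cohomology_classB.
by rewrite !cohomology_mapE cocycle_map_zmod cohomology_classB.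
Qed.

HB.instance Definition _ n :=
  GRing.isZmodMorphism.Build _ _ (@cohomology_map n) (@cohomology_map_zmod n).

Lemma cohomology_map_bij n : bijective (@cohomology_map n).
Proof.
have [k kK Kk] := f_bij n.
have k_in (z : cocycles S' n) : k (cocycle_val z) \in @cocycle _ S n.
  by rewrite -cocycle_image Kk; apply: valP.
pose g (z : cocycles S' n) : cocycles S n := Cocycle (k_in z).
have gK z : cocycle_map (g z) = z by apply: val_inj; apply: Kk.
exists (fun q => cohomology_class (g (repr q))) => q; last first.
  by rewrite cohomology_mapE gK; apply: reprK.
rewrite -[RHS]reprK; apply/eqP.
rewrite cohomology_class_eq -coboundary_image cocycle_map_zmod gK.
by rewrite -cohomology_class_eq /cohomology_class reprK.
Qed.

Lemma induced_iso_exists n :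
  exists h : {additive cohomology S n -> cohomology S' n},
    induced_iso (fun n => f n) h.
Proof.
exists (@cohomology_map n); split; first exact: cohomology_map_bij.
by move=> z; exists (cocycle_map z) => //; apply: cohomology_mapE.
Qed.

End InducedMap.

Theorem theorem9 (C D : braidedCat) (T : tensorFunctor C D)
    (A : ribbonData C) (hA : is_ribbon_algebra A) :
  [/\ mulB (ribbon_image T A)
        = coe (barT_letter T A) \c barT T (mulB A)
            \c coe (esym (barT_letter2 T A)),
      is_ribbon_algebra (ribbon_image T A),
      cocyclic_morphism (@barT_cochain C D T A) &
      invertible T ->
      [/\ cocyclic_isomorphism (@barT_cochain C D T A),
          forall n, exists h : {additive HH (ribbon_cocyclic A) n ->
                                  HH (ribbon_cocyclic (ribbon_image T A)) n},
            induced_iso (@barT_cochain C D T A) h &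
          forall n, exists h : {additive HC (ribbon_cocyclic A) n ->
                                  HC (ribbon_cocyclic (ribbon_image T A)) n},
            induced_iso (@barT_cochain C D T A) h]].
Proof.
split.
- apply: barT_img_fun (barT_img_mul T A) _.
  by exists (barT_letter2 T A), (barT_letter T A).
- exact: ribbon_image_ribbon.
- exact: barT_cochain_morphism.
move=> invT.
have ffT U V := invertible_bij U V invT.
have fbij := barT_cochain_bij ffT A.
have finj n := bij_inj (fbij n).
pose f n : {additive ambient (ribbon_cocyclic A) n ->
    ambient (ribbon_cocyclic (ribbon_image T A)) n} :=
  HB.pack (@barT_cochain C D T A n)
   (GRing.isZmodMorphism.Build _ _ (@barT_cochain C D T A n)
     (@barT_cochain_zmod C D T A n)).
split.
- have [g [gK Kg]] : exists g : forall n,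
      ambient (ribbon_cocyclic (ribbon_image T A)) n ->
      ambient (ribbon_cocyclic A) n,
    (forall n, cancel (@barT_cochain C D T A n) (g n)) /\
    (forall n, cancel (g n) (@barT_cochain C D T A n)).
    have ex n : exists g, cancel (@barT_cochain C D T A n) g /\
        cancel g (@barT_cochain C D T A n).
      by case: (fbij n) => g gK Kg; exists g.
    exists (fun n => sval (cid (ex n))).
    by split=> n; case: cid => g [].
  apply: (cocyclic_morphism_inv (barT_cochain_morphism T A) gK Kg).
  by move=> n x; apply: barT_cochain_in.
- move=> n; apply: (@induced_iso_exists _ _ f (cochain _) (cochain _)) => //.
  + by move=> m x; apply: barT_cochain_in.
  + exact: barT_cochain_face.
- move=> n.
  apply: (@induced_iso_exists _ _ f (@cyclic_cochain _) (@cyclic_cochain _)) => //.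
  + by move=> m x; apply: barT_cyclic_in.
  + exact: barT_cochain_face.
Qed.
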